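(* Let $n\ge1$, let $\pi\in\mathfrak{S}_n$ be a meandric permutation, and let $\Gamma(\pi)$ be its meandric graph. Then the adjacency matrix $M$ of $\Gamma(\pi)$ is idempotent over the field $\mathsf{GF}(2)$, i.e. $M^2=M$ over $\mathsf{GF}(2)$.
   Context: Meanders: a meander of order $n$ is a triple $(\mathcal{D},\{m_0,m_1,p_0,p_1\},\{\mu,\ell\})$ where $\mathcal{D}$ is a 2-dimensional (closed) disk; $m_0,m_1,p_0,p_1$ are four distinct points of $\partial\mathcal{D}$ such that some connected component of $\partial\mathcal{D}\setminus\{m_0,p_0\}$ contains both $m_1$ and $p_1$; and $\mu,\ell:[0,1]\to\mathcal{D}$ are smooth proper embeddings with $\mu(0)=m_0$, $\mu(1)=m_1$, $\ell(0)=p_0$, $\ell(1)=p_1$, such that the curves $\mu$ and $\ell$ intersect transversely, in exactly $n$ points. Meandric permutations: label the $n$ intersection points of $\mu$ and $\ell$ by $1,\dots,n$ in the order they are met moving along $\ell$ from $p_0$ to $p_1$. The permutation of the meander is $\pi\in\mathfrak{S}_n$ where $\pi(k)$ is the label of the $k$-th intersection point met moving along $\mu$ from $m_0$ to $m_1$. A permutation is meandric if it is the permutation of some meander of order $n$. Meandric graph: for $\pi\in\mathfrak{S}_n$ consider the cyclic double occurrence word $$W(\pi)=(0,1,2,\dots,n,\theta_n,0,\pi(1),\pi(2),\dots,\pi(n),\theta_n),$$ where $0$ and $\theta_n$ are extra letters different from $1,\dots,n$ and from each other, and $\theta_n$ is the empty symbol (i.e. is omitted) if and only if $n$ is even. The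 graph $\Gamma(\pi)$ is the interlacement (chord-intersection) graph of the corresponding chord diagram: its vertices are the letters of $W(\pi)$, and two distinct letters $a,b$ are adjacent iff their chords cross, i.e. iff their occurrences alternate $a\,b\,a\,b$ in the cyclic word. When $\pi$ is meandric, $\Gamma(\pi)$ is called a meandric graph. The adjacency matrix has entry $1$ at adjacent pairs of vertices and $0$ elsewhere (in particular zero diagonal). *)

(* Defs.v *)
From mathcomp Require Export all_boot all_order all_algebra all_fingroup.
From mathcomp Require Export all_classical all_reals all_analysis.

Set Implicit Arguments.
Unset Strict Implicit.
Unset Printing Implicit Defensive.

Export Order.TTheory GRing.Theory Num.Theory.
Export numFieldNormedType.Exports.

Local Open Scope classical_set_scope.
Local Open Scope ring_scope.

Section Meanders.
Variable R : realType.
Implicit Types (p q o : R * R) (r : R) (c : R -> R * R).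

Definition dist2 p q : R := (p.1 - q.1) ^+ 2 + (p.2 - q.2) ^+ 2.

Definition disk o r : set (R * R) := [set p | dist2 p o <= r ^+ 2].

Definition disk_boundary o r : set (R * R) := [set p | dist2 p o = r ^+ 2].

Definition smooth_fun (f : R -> R) : Prop :=
  forall (k : nat) (t : R), derivable (derive1n k f) t 1.

(* A smooth curve [0,1] -> R^2 is given by a smooth extension to all of R;
   everything below only depends on the values of c on [0,1]. *)
Definition smooth_curve c : Prop :=
  smooth_fun (fst \o c) /\ smooth_fun (snd \o c).

Definition velocity c (t : R) : R * R :=
  (derive1 (fst \o c) t, derive1 (snd \o c) t).

Definition curve_image c : set (R * R) := c @` `[0, 1].

(* As [0,1] is compact, an injective immersion of it is a homeomorphism onto
   its image.  Proper (for arcs in a disk) means that exactly the endpoints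
   are sent to the boundary. *)
Record proper_smooth_embedding o r c : Prop := ProperSmoothEmbedding {
  pse_smooth : smooth_curve c;
  pse_inj : {in `[0, 1] &, injective c};
  pse_immersion : forall t, t \in `[0, 1] -> velocity c t != 0;
  pse_disk : forall t, t \in `[0, 1] -> disk o r (c t);
  pse_proper : forall t, t \in `[0, 1] ->
    (disk_boundary o r (c t) <-> t = 0 \/ t = 1)
}.

(* Linear independence of the two velocities, via their determinant. *)
Definition transverse c1 c2 : Prop :=
  forall s t, s \in `[0, 1] -> t \in `[0, 1] -> c1 s = c2 t ->
    (velocity c1 s).1 * (velocity c2 t).2
      - (velocity c1 s).2 * (velocity c2 t).1 != 0.

Record meander (n : nat) := Meander {
  disk_center : R * R;
  disk_radius : R;
  m0 : R * R;
  m1 : R * R;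
  p0 : R * R;
  p1 : R * R;
  mu : R -> R * R;
  ell : R -> R * R;
  radius_gt0 : 0 < disk_radius;
  points_on_boundary :
    [/\ disk_boundary disk_center disk_radius m0, disk_boundary disk_center disk_radius m1,
        disk_boundary disk_center disk_radius p0 & disk_boundary disk_center disk_radius p1];
  points_distinct : uniq [:: m0; m1; p0; p1];
  points_component : exists x,
    let C := connected_component
               (disk_boundary disk_center disk_radius `\` [set m0; p0]) x in
    C m1 /\ C p1;
  mu_embedding : proper_smooth_embedding disk_center disk_radius mu;
  ell_embedding : proper_smooth_embedding disk_center disk_radius ell;
  mu_ends : mu 0 = m0 /\ mu 1 = m1;
  ell_ends : ell 0 = p0 /\ ell 1 = p1;
  mu_ell_transverse : transverse mu ell;
  mu_ell_card : ((curve_image mu `&` curve_image ell) #= `I_n)%card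
}.

Definition crossings n (M : meander n) : set (R * R) :=
  curve_image (mu M) `&` curve_image (ell M).

(* x lists the points of X in the order they are met moving along c. *)
Definition met_in_order n c (X : set (R * R)) (x : 'I_n -> R * R) : Prop :=
  exists t : 'I_n -> R,
    [/\ forall i, t i \in `[0, 1],
        forall i j : 'I_n, (i < j)%N -> t i < t j,
        forall i, x i = c (t i)
      & range x = X].

(* Points and labels are numbered from 0: i : 'I_n stands for i + 1. *)
Definition is_permutation_of n (M : meander n) (pi : 'S_n) : Prop :=
  exists x y : 'I_n -> R * R,
    [/\ met_in_order (ell M) (crossings M) x,
        met_in_order (mu M) (crossings M) y
      & forall k, y k = x (pi k)].

Definition meandric n (pi : 'S_n) : Prop :=
  exists M : meander n, is_permutation_of M pi.

End Meanders.

(* The letters of W(pi) are 0, 1, ..., n and, for n odd, theta = n.+1. *)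
Definition theta (n : nat) : seq nat := if odd n then [:: n.+1] else [::].

Definition W n (pi : 'S_n) : seq nat :=
  (iota 0 n.+1 ++ theta n)
    ++ (0%N :: [seq (pi i).+1 | i <- enum 'I_n] ++ theta n).

(* A linear reading of a cyclic word in which a and b alternate as a b a b
   starts with either letter. *)
Definition interlaced (w : seq nat) : rel nat := fun a b =>
  (a != b) &&
  ([seq x <- w | (x == a) || (x == b)]
     \in [:: [:: a; b; a; b]; [:: b; a; b; a]]).

Definition Gamma n (pi : 'S_n) : rel 'I_(n.+1 + odd n) :=
  fun a b => interlaced (W pi) a b.

Definition adjacency_matrix (F : pzRingType) (m : nat) (e : rel 'I_m) :
  'M[F]_m := \matrix_(a < m, b < m) (e a b)%:R.

Arguments meandric R {n} pi.
Arguments adjacency_matrix F {m} e.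

(* Main.v *)
Require Import Defs.
From mathcomp Require Import ring lra.

(** For [n] of either parity, [n.+1 + odd n] is odd and the two linear orders in
    which [W pi] lists its letters make [Gamma pi] the non-inversion graph of a
    permutation of the letters; so [M = J + 1 + V] with [J] the all-one matrix and
    [V] the inversion matrix, and [M^2 = M] amounts to [V^2 = V].  The extra
    letters are never inverted, so this concerns the crossings only.

    Locating a crossing by its parameters on the two curves, [V^2 = V] follows
    from parities of numbers of crossings in rectangles of parameters.  Take the
    loop formed by the two outgoing branches at a crossing, followed up to another
    crossing or up to the boundary, where they are joined by a boundary arc.  The
    two incoming branches start on the boundary, outside of this loop, and reach
    the corner of the loop on the same side of it, so they cross it the same
    number of times modulo 2.

    Sides of a loop are told apart by winding numbers modulo 2, computed with a
    cocycle that detects when a short segment crosses the positive x-axis; the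
    winding number of [c t - v u] along the boundary of a rectangle is the parity
    of the number of transverse zeros inside. *)

Set Implicit Arguments.
Unset Strict Implicit.
Unset Printing Implicit Defensive.

Local Open Scope ring_scope.

(** * A mod 2 angle cocycle *)

Section PlaneAlgebra.
Variable R : realType.
Implicit Types (p q r l : R * R) (a b : R).

Definition dot p q : R := p.1 * q.1 + p.2 * q.2.
Definition cross p q : R := p.1 * q.2 - p.2 * q.1.

(** The vectors of polar angle in [0, π). The half-open choice contains exactly one of [p] and [- p]
    for every nonzero [p]. *)
Definition upper p : bool := (0 < p.2) || (p.2 == 0) && (0 < p.1).

(* Whether the segment from [p] to [q] meets the positive x-axis; meaningful
   only when that segment avoids the origin. *)
Definition ray_cross p q : bool :=
  if upper p == upper q then false
  else if upper p then cross p q < 0 else 0 < cross p q.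

Lemma ray_crossC p q : ray_cross p q = ray_cross q p.
Proof.
rewrite /ray_cross eq_sym.
have -> : cross q p = - cross p q by rewrite /cross; ring.
by rewrite oppr_lt0 oppr_gt0; case: (upper p); case: (upper q).
Qed.

Lemma ray_crossxx p : ray_cross p p = false.
Proof. by rewrite /ray_cross eqxx. Qed.

Lemma upperP p : reflect (0 < p.2 \/ p.2 = 0 /\ 0 < p.1) (upper p).
Proof.
apply: (iffP orP) => -[? | H]; try by left.
  by right; case/andP: H => /eqP.
by right; case: H => -> ->; rewrite eqxx.
Qed.

Lemma upperN p : p != 0 -> upper (- p) = ~~ upper p.
Proof.
case: p => x y; rewrite -pair_eqE /= negb_and /upper /= oppr_gt0 oppr_eq0.
rewrite oppr_gt0.
by case: (ltgtP y 0) => //= _; case: (ltgtP x 0).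
Qed.

Lemma scale_pairE a (x y : R) : a *: (x, y) = (a * x, a * y).
Proof. by []. Qed.

Lemma upper_cone p q a b : upper p -> upper q -> 0 <= a -> 0 < b ->
  upper (a *: p + b *: q).
Proof.
move=> /upperP /= hp /upperP /= hq ha hb; apply/upperP.
case: p q hp hq => [x y] [z t] /= hp hq.
rewrite -![_ *: _]/(_ * _).
case: hq => [t0|[t0 z0]].
  left; have : 0 < b * t by nra.
  case: hp => [y0|[y0 _]]; last by rewrite y0 mulr0; lra.
  have : 0 <= a * y by nra.
  lra.
rewrite t0 mulr0 addr0.
have bz : 0 < b * z by nra.
case: hp => [y0|[y0 x0]].
  have [->|a0] := eqVneq a 0; first by right; rewrite !mul0r; split => //; lra.
  left; have : 0 < a by rewrite lt_neqAle eq_sym a0.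
  nra.
right; rewrite y0 mulr0; split => //; have : 0 <= a * x by nra.
lra.
Qed.

Lemma upper_pos_scale p a : 0 < a -> upper (a *: p) = upper p.
Proof.
move=> a0; case: p => x y; rewrite scale_pairE /upper /= !pmulr_rgt0 //.
by rewrite mulf_eq0 gt_eqF.
Qed.

Lemma dot_neq0 l p : 0 < dot l p -> p != 0.
Proof. by apply: contraTneq => ->; rewrite /dot /= !mulr0 addr0 ltxx. Qed.

Lemma dotNN l p : dot (- l) (- p) = dot l p.
Proof. by rewrite /dot /=; ring. Qed.

Lemma crossNN p q : cross (- p) (- q) = cross p q.
Proof. by rewrite /cross /=; ring. Qed.

(** Parallel vectors in the open half-plane of [l] are positive multiples of each other, hence agree
    for [upper]. *)
Lemma cross_neq0 l p q : 0 < dot l p -> 0 < dot l q ->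
  upper p -> ~~ upper q -> cross p q != 0.
Proof.
move=> hp hq up uq; apply: contra uq => /eqP c0.
rewrite -(upper_pos_scale _ hp).
suff -> : dot l p *: q = dot l q *: p by rewrite upper_pos_scale.
case: l p q hp hq up c0 => [a b] [x y] [z t]; rewrite /dot /cross /= => _ _ _ c0.
rewrite !scale_pairE; congr pair; apply/eqP; rewrite -subr_eq0; apply/eqP.
  by transitivity (- b * (x * t - y * z)); [ring | rewrite c0 mulr0].
by transitivity (a * (x * t - y * z)); [ring | rewrite c0 mulr0].
Qed.

(** If the signs differed, [r] would be a nonnegative combination of [p] and [q] and so would belong
    to the convex cone [upper]. *)
Lemma cross_lt0 l p q r : 0 < dot l p -> 0 < dot l q -> 0 < dot l r ->
  upper p -> upper q -> ~~ upper r -> (cross p r < 0) = (cross q r < 0).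
Proof.
wlog suff: p q / 0 < dot l p -> 0 < dot l q -> 0 < dot l r ->
  upper p -> upper q -> ~~ upper r -> cross p r < 0 -> cross q r < 0.
  by move=> H lp lq lr up uq ur; apply/idP/idP; apply: H.
move=> lp lq lr up uq ur pr; rewrite ltNge; apply: contra ur => qr.
(* The form [l] is applied to the linear relation between three plane vectors whose coefficients are
   their pairwise cross products. *)
have id : cross q r * dot l p - cross p r * dot l q + cross p q * dot l r = 0.
  by rewrite /cross /dot; ring.
have pq : 0 < - cross p q.
  have : 0 < - cross p r * dot l q by rewrite mulNr oppr_gt0 nmulr_rlt0.
  have : 0 <= cross q r * dot l p by rewrite mulr_ge0 // ltW.
  move=> h1 h2; have : cross p q * dot l r < 0 by lra.
  by rewrite pmulr_llt0 // oppr_gt0.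
rewrite -(upper_pos_scale _ pq).
have -> : (- cross p q) *: r = cross q r *: p + (- cross p r) *: q.
  case: (p) (q) (r) => [a b] [x y] [z t].
  by rewrite /cross !scale_pairE /=; congr pair => /=; ring.
by apply: upper_cone => //; rewrite oppr_gt0.
Qed.

Lemma cross_gt0 l p q r : 0 < dot l p -> 0 < dot l q -> 0 < dot l r ->
  upper p -> upper q -> ~~ upper r -> (0 < cross p r) = (0 < cross q r).
Proof.
move=> lp lq lr up uq ur.
have := cross_lt0 lp lq lr up uq ur.
have := cross_neq0 lp lr up ur; have := cross_neq0 lq lr uq ur.
move=> /negbTE q0 /negbTE p0 E.
by rewrite [LHS]ltNge [RHS]ltNge !le_eqVlt p0 q0 E.
Qed.

(** The cocycle relation: a triangle in an open half-plane does not surround the origin. Two of the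
    three vectors agree for [upper], and replacing one of them by the other does not change the
    crossing with the third. *)
Lemma ray_cross_half l p q r : 0 < dot l p -> 0 < dot l q -> 0 < dot l r ->
  ray_cross p q = ray_cross p r (+) ray_cross r q.
Proof.
move=> lp lq lr.
have main p' q' r' : 0 < dot l p' -> 0 < dot l q' -> 0 < dot l r' ->
    upper p' = upper q' -> ray_cross p' r' = ray_cross q' r'.
  move=> {lp lq lr}p0 q0 r0 pq; rewrite /ray_cross -pq.
  case up: (upper p'); case ur: (upper r') => //=.
    by apply: (@cross_lt0 l) => //; rewrite ?ur -?pq ?up.
  (* When [p'] and [q'] are not in [upper], all vectors and [l] are negated. *)
  have N z : 0 < dot l z -> upper (- z) = ~~ upper z.
    by move/dot_neq0/upperN.
  rewrite -crossNN -[in RHS]crossNN.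
  by apply: (@cross_gt0 (- l)); rewrite ?dotNN // N // -?pq ?up ?ur.
have [pq|npq] := eqVneq (upper p) (upper q).
  by rewrite (main p q r) // [ray_cross r q]ray_crossC addbb /ray_cross pq eqxx.
have [pr|npr] := eqVneq (upper p) (upper r).
  by rewrite [ray_cross p r]/ray_cross pr eqxx (main p r q).
have qr : upper q = upper r.
  by move: npq npr; case: (upper p); case: (upper q); case: (upper r).
by rewrite [ray_cross r q]/ray_cross qr eqxx addbF ray_crossC
  (main q r p) // ray_crossC.
Qed.

(** The quadrilateral [p], [q], [- p], [- q] goes once around the origin. *)
Lemma ray_cross_antipodal p q : cross p q != 0 ->
  ray_cross p q (+) ray_cross q (- p) (+) ray_cross (- p) (- q)
    (+) ray_cross (- q) p = true.
Proof.
move=> c; have p0 : p != 0.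
  by apply: contraNneq c => ->; rewrite /cross /= !mul0r subrr.
have q0 : q != 0.
  by apply: contraNneq c => ->; rewrite /cross /= !mulr0 subrr.
rewrite /ray_cross !upperN // crossNN.
have -> : cross q (- p) = cross p q by rewrite /cross /=; ring.
have -> : cross (- q) p = cross p q by rewrite /cross /=; ring.
by case: (upper p); case: (upper q) => /=; move: c; case: ltgtP.
Qed.

(* [u] and [v] are the axes; the four points lie in the four open quadrants. *)
Lemma ray_cross_square u v p q r s : cross u v != 0 ->
  0 < cross u v * cross p v -> 0 < cross u v * cross q v ->
  0 < cross u v * cross u q -> 0 < cross u v * cross u r ->
  cross u v * cross r v < 0 -> cross u v * cross s v < 0 ->
  cross u v * cross u s < 0 -> cross u v * cross u p < 0 ->
  ray_cross p q (+) ray_cross q r (+) ray_cross r s (+) ray_cross s p = true.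
Proof.
set D := cross u v => D0 pv qv uq ur rv sv us up.
pose lv : R * R := D *: (v.2, - v.1); pose lu : R * R := D *: (- u.2, u.1).
have lvE z : dot lv z = D * cross z v.
  by rewrite /dot /lv /cross scale_pairE /=; ring.
have luE z : dot lu z = D * cross u z.
  by rewrite /dot /lu /cross scale_pairE /=; ring.
have nE l z : dot (- l) z = - dot l z by rewrite /dot /=; ring.
(* The vectors [a], [b], [- a], [- b] lie in the quadrants of [p], [q], [r], [s]; each side of the
   square is compared, inside a half-plane, with the corresponding side of this antipodal
   quadrilateral. *)
pose a := u - v; pose b := u + v.
have D2 : 0 < D * D by rewrite -expr2 exprn_even_gt0.
have av : cross a v = D by rewrite /a /D /cross /=; ring.
have bv : cross b v = D by rewrite /b /D /cross /=; ring.
have ua : cross u a = - D by rewrite /a /D /cross /=; ring.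
have ub : cross u b = D by rewrite /b /D /cross /=; ring.
have Nv z : cross (- z) v = - cross z v by rewrite /cross /=; ring.
have uN z : cross u (- z) = - cross u z by rewrite /cross /=; ring.
have e1 : ray_cross p q = ray_cross p a (+) (ray_cross a b (+) ray_cross b q).
  rewrite (@ray_cross_half lv p q a) ?lvE ?av //.
  by rewrite (@ray_cross_half lv a q b) ?lvE ?av ?bv.
have e2 : ray_cross q r = ray_cross q b (+) (ray_cross b (- a) (+) ray_cross (- a) r).
  rewrite (@ray_cross_half lu q r b) ?luE ?ub //.
  by rewrite (@ray_cross_half lu b r (- a)) ?luE ?uN ?ua ?ub ?opprK.
have e3 : ray_cross r s = ray_cross r (- a) (+) (ray_cross (- a) (- b) (+) ray_cross (- b) s).
  rewrite (@ray_cross_half (- lv) r s (- a)) ?nE ?lvE ?Nv ?av ?mulrN ?opprK ?oppr_gt0 //.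
  by rewrite (@ray_cross_half (- lv) (- a) s (- b)) ?nE ?lvE ?Nv ?av ?bv ?mulrN ?opprK ?oppr_gt0.
have e4 : ray_cross s p = ray_cross s (- b) (+) (ray_cross (- b) a (+) ray_cross a p).
  rewrite (@ray_cross_half (- lu) s p (- b)) ?nE ?luE ?uN ?ub ?mulrN ?opprK ?oppr_gt0 //.
  by rewrite (@ray_cross_half (- lu) (- b) p a) ?nE ?luE ?uN ?ua ?ub ?mulrN ?opprK ?oppr_gt0.
have ab : cross a b != 0.
  have -> : cross a b = 2 * D by rewrite /a /b /D /cross /=; ring.
  by rewrite mulf_neq0 // pnatr_eq0.
rewrite e1 e2 e3 e4 -(ray_cross_antipodal ab).
rewrite (ray_crossC b q) (ray_crossC r (- a)) (ray_crossC s (- b)) (ray_crossC a p).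
move: (ray_cross p a) (ray_cross q b) (ray_cross (- a) r) (ray_cross (- b) s).
move: (ray_cross a b) (ray_cross b (- a)) (ray_cross (- a) (- b)).
move: (ray_cross (- b) a).
by do 8!case.
Qed.

End PlaneAlgebra.

(** * Winding numbers modulo 2 *)

Section Winding.
Local Open Scope classical_set_scope.
Local Open Scope ring_scope.
Variable R : realType.
Implicit Types (p q l : R * R) (a b t u d : R) (g h c v : R -> R * R).

(** Compactness of [[a, b]] as a continuous induction: the supremum of the [x] with [P a x] is
    reached, by the local hypothesis on its left, and cannot be below [b], by the same hypothesis on
    its right. *)
Lemma interval_chain (P : R -> R -> Prop) a b : a <= b ->
  (forall x y z, x <= y -> y <= z -> P x y -> P y z -> P x z) ->
  (forall x, a <= x <= b -> exists2 U : set R, nbhs x U &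
     forall y z, (forall t, y <= t <= z -> U t) ->
       a <= y <= x -> x <= z <= b -> P y z) ->
  P a b.
Proof.
move=> ab trans loc.
pose S := [set x | a <= x <= b /\ P a x].
have Sa : S a.
  have aab : a <= a <= b by rewrite lexx.
  have [U /nbhs_singleton Ua HU] := loc a aab.
  split => //; apply: HU; rewrite ?lexx // => t.
  by rewrite -eq_le => /eqP <-.
have Sb : ubound S b by move=> x [/andP[_ ->]].
have supS : has_sup S by split; [exists a | exists b].
have ac : a <= sup S by apply: ub_le_sup; [exists b | ].
have cb : sup S <= b by apply: ge_sup; [exists a | ].
set c := sup S in ac cb.
have acb : a <= c <= b by rewrite ac cb.
have [U /nbhs_ballP[d /= d0 dU] HU] := loc c acb.
have Uc z : `|c - z| < d -> U z by move=> h; apply: dU; rewrite /ball /=.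
have Pac : P a c.
  have [y Sy yc] := sup_adherent d0 supS.
  have yc' : y <= c by apply: ub_le_sup => //; exists b.
  case: Sy => /andP[ay yb] Pay.
  apply: (trans _ y) => //; apply: HU; rewrite ?ay ?yc' ?lexx ?cb //.
  move=> t /andP[yt tc]; apply: Uc; rewrite ger0_norm ?subr_ge0 //.
  by move: yc; rewrite -/c; lra.
move: cb; rewrite le_eqVlt => /predU1P[<- // | cltb].
pose z := Num.min b (c + d / 2).
have cz : c < z by rewrite lt_min cltb ltrDl divr_gt0.
have zb : z <= b by rewrite ge_min lexx.
have zd : z <= c + d / 2 by rewrite ge_min lexx orbT.
have : S z.
  split; first by rewrite (le_trans ac (ltW cz)).
  apply: (trans _ c) => //; first exact: ltW.
  apply: HU; rewrite ?ac ?lexx ?(ltW cz) // => t /andP[ct tz].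
  apply: Uc; rewrite distrC ger0_norm ?subr_ge0 //.
  by move: (d0 : 0 < d); lra.
move=> Sz; have zc : z <= c by apply: ub_le_sup => //; exists b.
by move: (lt_le_trans cz zc); rewrite ltxx.
Qed.

(** Two-sided continuity, even at the endpoints: curves are functions on the whole line. *)
Definition continuous_on g a b := forall t, a <= t <= b ->
  {for t, continuous (fst \o g)} /\ {for t, continuous (snd \o g)}.

Lemma sub_continuous_on g a b a' b' : a <= a' -> b' <= b ->
  continuous_on g a b -> continuous_on g a' b'.
Proof.
move=> aa bb C t /andP[h1 h2]; apply: C.
by rewrite (le_trans aa h1) (le_trans h2 bb).
Qed.

Lemma continuous_on_subr g p a b : continuous_on g a b ->
  continuous_on (fun t => g t - p) a b.
Proof. by move=> C t /C [C1 C2]; split; apply: cvgB => //; exact: cvg_cst. Qed.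

Lemma continuous_on_subl g p a b : continuous_on g a b ->
  continuous_on (fun t => p - g t) a b.
Proof. by move=> C t /C [C1 C2]; split; apply: cvgB => //; exact: cvg_cst. Qed.

Lemma dot_gt0 p : p != 0 -> 0 < dot p p.
Proof.
case: p => x y; rewrite -pair_eqE /= negb_and /dot /= -!expr2 => /orP[] h.
  by rewrite ltr_wpDr ?sqr_ge0 // exprn_even_gt0.
by rewrite ltr_wpDl ?sqr_ge0 // exprn_even_gt0.
Qed.

Lemma near_dot l g a b t : continuous_on g a b -> a <= t <= b ->
  0 < dot l (g t) -> \forall y \near t, 0 < dot l (g y).
Proof.
move=> C /C [C1 C2] h.
have : (fun y => dot l (g y)) @ t --> dot l (g t).
  by apply: cvgD; apply: cvgM => //; exact: cvg_cst.
by move/cvgr_gt; apply.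
Qed.

(* A lift of [g] to the connected double cover of the punctured plane. *)
Definition is_lift g a b (f : R -> bool) := forall x, a <= x <= b ->
  \forall y \near x, a <= y <= b -> f x (+) f y = ray_cross (g x) (g y).

(** Whether a lift changes sheet between [a] and [b]; [false] by default when there is no lift. *)
Definition winding g a b : bool :=
  `[< exists2 f, is_lift g a b f & f a (+) f b >].

(** Two lifts of one curve differ by a locally constant function, so the choice of the lift does not
    matter. *)
Lemma windingE g a b f : a <= b -> is_lift g a b f ->
  winding g a b = f a (+) f b.
Proof.
move=> ab lf.
have uniq f' : is_lift g a b f' -> f' a (+) f' b = f a (+) f b.
  move=> lf'.
  apply: (@interval_chain (fun y z => f' y (+) f' z = f y (+) f z) a b) => //.
    move=> x y z _ _.
    by case: (f' x) (f' y) (f' z) (f x) (f y) (f z) => [] [] [] [] [] [].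
  move=> x xab; exists [set y | a <= y <= b -> f x (+) f y = f' x (+) f' y].
    near=> y => /= yab.
    by rewrite (near (lf x xab) y) // (near (lf' x xab) y).
  move=> y z /= U /andP[ay yx] /andP[xz zb].
  have yz := le_trans yx xz.
  have := U y; rewrite lexx yz ay (le_trans yz zb) => /(_ isT isT).
  have := U z; rewrite lexx yz zb (le_trans ay yz) => /(_ isT isT).
  by case: (f x) (f y) (f z) (f' x) (f' y) (f' z) => [] [] [] [] [] [].
apply/asboolP/idP => [[f' /uniq <-]//|h]; by exists f.
Unshelve. all: by end_near.
Qed.

Lemma sub_lift g a b a' b' f : a <= a' -> b' <= b ->
  is_lift g a b f -> is_lift g a' b' f.
Proof.
move=> aa bb lf x /andP[h1 h2].
have xab : a <= x <= b by rewrite (le_trans aa h1) (le_trans h2 bb).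
near=> y => /andP[h3 h4].
have yab : a <= y <= b by rewrite (le_trans aa h3) (le_trans h4 bb).
by apply: (near (lf x xab) y).
Unshelve. all: by end_near.
Qed.

Lemma half_lift g a b l : (forall t, a <= t <= b -> 0 < dot l (g t)) ->
  a <= b -> is_lift g a b (fun t => ray_cross (g a) (g t)).
Proof.
move=> hl ab x xab; near=> y => yab.
have aab : a <= a <= b by rewrite lexx.
by rewrite (ray_crossC _ (g x)) -(@ray_cross_half _ l) ?hl.
Unshelve. all: by end_near.
Qed.

Lemma winding_half g a b l : a <= b ->
  (forall t, a <= t <= b -> 0 < dot l (g t)) ->
  winding g a b = ray_cross (g a) (g b).
Proof.
by move=> ab hl; rewrite (windingE ab (half_lift hl ab)) ray_crossxx.
Qed.

Lemma lift_exists g a b : a <= b -> continuous_on g a b ->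
  (forall t, a <= t <= b -> g t != 0) -> exists f, is_lift g a b f.
Proof.
move=> ab C g0.
apply: (@interval_chain (fun y z => exists f, is_lift g y z f)) => //.
  move=> x y z xy yz [f1 l1] [f2 l2].
  (* The lifts are glued at [y], the second one being shifted by a constant so that they agree
     there. *)
  exists (fun t => if t <= y then f1 t else f2 t (+) f2 y (+) f1 y) => t /andP[xt tz].
  case: (ltgtP t y) => ty.
  - have txy : x <= t <= y by rewrite xt ltW.
    near=> w => /andP[xw wz].
    have wy : w <= y by apply/ltW; near: w; exact: lt_nbhsl.
    by rewrite wy; apply: (near (l1 t txy) w); rewrite // xw.
  - have tyz : y <= t <= z by rewrite tz ltW.
    near=> w => /andP[xw wz].
    have wy : y < w by near: w; exact: lt_nbhsr.
    rewrite leNgt wy /=.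
    have <- := near (l2 t tyz) w; rewrite ?wz ?ltW //.
    by case: (f2 t) (f2 w) (f2 y) (f1 y) => [] [] [] [].
  - subst t.
    have yxy : x <= y <= y by rewrite xy lexx.
    have yyz : y <= y <= z by rewrite yz lexx.
    near=> w => /andP[xw wz].
    case: (leP w y) => wy.
      by apply: (near (l1 y yxy) w); rewrite // xw.
    have <- := near (l2 y yyz) w; rewrite ?wz ?ltW //.
    by case: (f2 y) (f2 w) (f1 y) => [] [] [].
(* Near [x] the curve stays in the half-plane around [g x], where the cocycle from a base point is a
   lift. *)
move=> x xab; exists [set y | 0 < dot (g x) (g y)].
  exact: near_dot C xab (dot_gt0 (g0 x xab)).
move=> y z /= U /andP[_ yx] /andP[xz _].
exists (fun t => ray_cross (g y) (g t)).
exact: half_lift U (le_trans yx xz).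
Unshelve. all: by end_near.
Qed.

Lemma winding_cat g a b d : a <= b -> b <= d -> continuous_on g a d ->
  (forall t, a <= t <= d -> g t != 0) ->
  winding g a d = winding g a b (+) winding g b d.
Proof.
move=> ab bd C g0; have ad := le_trans ab bd.
have [f lf] := lift_exists ad C g0.
rewrite (windingE ad lf) (windingE ab (sub_lift (lexx a) bd lf)).
rewrite (windingE bd (sub_lift ab (lexx d) lf)).
by case: (f a) (f b) (f d) => [] [] [].
Qed.

(** As [g t] and [h t] form an acute angle, adding [ray_cross (g t) (h t)] to a lift of [g] gives a
    lift of [h]. *)
Lemma winding_homotopy g h a b : a <= b ->
  continuous_on g a b -> continuous_on h a b ->
  (forall t, a <= t <= b -> 0 < dot (g t) (h t)) ->
  winding h a b = winding g a b
    (+) (ray_cross (g a) (h a) (+) ray_cross (g b) (h b)).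
Proof.
move=> ab Cg Ch gh.
have g0 t : a <= t <= b -> g t != 0.
  by move/gh; apply: contraTneq => ->; rewrite /dot /= !mul0r addr0 ltxx.
have [f lf] := lift_exists ab Cg g0.
pose f' t := f t (+) ray_cross (g t) (h t).
have lf' : is_lift h a b f'.
  move=> x xab; rewrite /f'.
  have gx := gh x xab; have gx0 := dot_gt0 (g0 x xab).
  near=> y => yab.
  have gy : 0 < dot (g x) (g y) by near: y; exact: near_dot Cg xab gx0.
  have hy : 0 < dot (g x) (h y) by near: y; exact: near_dot Ch xab gx.
  have lfy := near (lf x xab) y.
  rewrite (ray_cross_half gx hy gy) (ray_cross_half gx gy gx0).
  rewrite -lfy //.
  rewrite (ray_crossC (h x)).
  by move: (f x) (f y) (ray_cross _ _) (ray_cross _ _) => [] [] [] [].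
rewrite (windingE ab lf) (windingE ab lf') /f'.
by move: (f a) (f b) (ray_cross _ _) (ray_cross _ _) => [] [] [] [].
Unshelve. all: by end_near.
Qed.

Definition avoids c a b p := forall t, a <= t <= b -> c t != p.

Lemma avoids_far c a b p : a <= b -> continuous_on c a b -> avoids c a b p ->
  exists2 m, 0 < m & forall t, a <= t <= b -> m <= dot (c t - p) (c t - p).
Proof.
move=> ab C av.
apply: (@interval_chain (fun y z => exists2 m, 0 < m &
  forall t, y <= t <= z -> m <= dot (c t - p) (c t - p))) => //.
  move=> x y z xy yz [m1 m10 h1] [m2 m20 h2].
  exists (Num.min m1 m2); first by rewrite lt_min m10.
  move=> t /andP[xt tz]; rewrite ge_min; case: (leP t y) => ty.
    by rewrite h1 // xt.
  by rewrite h2 ?orbT // (ltW ty).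
move=> x xab; pose k := dot (c x - p) (c x - p).
have k0 : 0 < k by apply: dot_gt0; rewrite subr_eq0; exact: av.
exists [set y | k / 2 < dot (c y - p) (c y - p)].
  have [C1 C2] := C x xab.
  have : (fun y => dot (c y - p) (c y - p)) @ x --> k.
    by apply: cvgD; apply: cvgM => //; apply: cvgB => //; exact: cvg_cst.
  by move/cvgr_gt; apply; lra.
move=> y z U _ _; exists (k / 2); first by lra.
by move=> t /U /ltW.
Qed.

Definition turning c a b p : bool := winding (fun t => c t - p) a b.

(** If [p] moves by less than its distance to the curve, the old and new vectors to each point of
    the curve form an acute angle; only the endpoints contribute to the change. *)
Lemma turning_near c a b p : a <= b -> continuous_on c a b ->
  avoids c a b p -> exists2 m, 0 < m & forall q, dot (q - p) (q - p) < m ->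
    avoids c a b q /\ turning c a b q = turning c a b p
      (+) (ray_cross (c a - p) (c a - q) (+) ray_cross (c b - p) (c b - q)).
Proof.
move=> ab C av; have [m m0 hm] := avoids_far ab C av.
exists m => // q qm.
have pos t : a <= t <= b -> 0 < dot (c t - p) (c t - q).
  move=> tab; have := hm t tab.
  (* Polarization identity, [q - p] being the difference of the two vectors. *)
  have : 2 * dot (c t - p) (c t - q) = dot (c t - p) (c t - p)
    + dot (c t - q) (c t - q) - dot (q - p) (q - p).
    by rewrite /dot /=; ring.
  have : 0 <= dot (c t - q) (c t - q) by rewrite addr_ge0 // -expr2 sqr_ge0.
  lra.
split; last exact: winding_homotopy ab (continuous_on_subr p C) (continuous_on_subr q C) pos.
move=> t /pos; apply: contraTneq => ->.
by rewrite subrr /dot /= !mulr0 addr0 ltxx.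
Qed.

Lemma near_dist v a b x m : continuous_on v a b -> a <= x <= b -> 0 < m ->
  \forall y \near x, dot (v y - v x) (v y - v x) < m.
Proof.
move=> C /C [C1 C2] m0.
have : (fun y => dot (v y - v x) (v y - v x)) @ x --> dot (v x - v x) (v x - v x).
  by apply: cvgD; apply: cvgM => //; apply: cvgB => //; exact: cvg_cst.
by rewrite subrr /dot /= !mulr0 addr0 => /cvgr_lt; apply.
Qed.

(* The vector [c t - v u] does not vanish on the rectangle, so its winding
   number along the boundary is zero. *)
Lemma turning_sweep c v a b u d : a <= b -> u <= d ->
  continuous_on c a b -> continuous_on v u d ->
  (forall x, u <= x <= d -> avoids c a b (v x)) ->
  turning c a b (v u) (+) turning c a b (v d)
    = winding (fun x => c a - v x) u d (+) winding (fun x => c b - v x) u d.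
Proof.
move=> ab ud Cc Cv av.
have aab : a <= a <= b by rewrite lexx.
have bab : a <= b <= b by rewrite ab lexx.
have v0 t x : a <= t <= b -> u <= x <= d -> c t - v x != 0.
  by move=> tab xud; rewrite subr_eq0 av.
(* [f1] and [f2] lift the vector along two opposite sides of the rectangle; the turning along the
   other direction is followed locally by [turning_near]. *)
have [f1 l1] := lift_exists ud (continuous_on_subl (c a) Cv) (fun x => v0 a x aab).
have [f2 l2] := lift_exists ud (continuous_on_subl (c b) Cv) (fun x => v0 b x bab).
rewrite (windingE ud l1) (windingE ud l2).
apply: (@interval_chain (fun y z =>
  turning c a b (v y) (+) turning c a b (v z) = f1 y (+) f1 z (+) (f2 y (+) f2 z))) => //.
  move=> x y z _ _.
  by move: (turning _ _ _ (v x)) (turning _ _ _ (v y)) (turning _ _ _ (v z))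
    (f1 x) (f1 y) (f1 z) (f2 x) (f2 y) (f2 z) => [] [] [] [] [] [] [] [] [].
move=> x xud; have [m m0 hm] := turning_near ab Cc (av x xud).
exists [set y | u <= y <= d ->
  turning c a b (v y) = turning c a b (v x) (+) (f1 x (+) f1 y (+) (f2 x (+) f2 y))].
  near=> y => yud /=.
  have [|_ ->] := hm (v y); first by near: y; exact: near_dist Cv xud m0.
  by rewrite (near (l1 x xud) y) // (near (l2 x xud) y).
move=> y z U /andP[uy yx] /andP[xz zd].
have yz := le_trans yx xz.
have := U y; rewrite lexx yz /= uy (le_trans yz zd) => /(_ isT isT) ->.
have := U z; rewrite lexx yz /= zd (le_trans uy yz) => /(_ isT isT) ->.
by move: (turning _ _ _ _) (f1 x) (f1 y) (f1 z) (f2 x) (f2 y) (f2 z)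
   => [] [] [] [] [] [] [].
Unshelve. all: by end_near.
Qed.

End Winding.

(** * A small square of parameters around a transverse crossing *)

Section Crossing.
Local Open Scope classical_set_scope.
Local Open Scope ring_scope.
Variable R : realType.
Implicit Types (p q l : R * R) (a b t u d e : R) (c v : R -> R * R).

Definition derivable_curve c := forall t,
  derivable (fst \o c) t 1 /\ derivable (snd \o c) t 1.

Lemma derivable_curve_continuous c a b : derivable_curve c -> continuous_on c a b.
Proof.
move=> dc t _; have [d1 d2] := dc t.
split; apply: differentiable_continuous; first exact/derivable1_diffP/d1.
exact/derivable1_diffP/d2.
Qed.

Lemma derive1_cvg (f : R -> R) t : derivable f t 1 ->
  h^-1 *: (f (h + t) - f t) @[h --> 0^'] --> derive1 f t.
Proof.
rewrite /derivable /derive1 => df.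
suff -> : (fun h : R => h^-1 *: (f (h + t) - f t)) =
          (fun h => h^-1 *: ((f \o shift t) (h *: 1) - f t)) by [].
by apply/funext => h /=; rewrite [h%:A]mulr1.
Qed.

Lemma dot_approx l c t (k : R) : derivable_curve c -> 0 < k ->
  \forall y \near t,
    `|dot l (c y) - dot l (c t) - (y - t) * dot l (velocity c t)| <= k * `|y - t|.
Proof.
move=> dc k0; have [d1 d2] := dc t.
have C : l.1 * (h^-1 *: ((fst \o c) (h + t) - (fst \o c) t))
         + l.2 * (h^-1 *: ((snd \o c) (h + t) - (snd \o c) t))
         @[h --> 0^'] --> dot l (velocity c t).
  by apply: cvgD; apply: cvgM; rewrite ?velocity /=;
    try exact: cvg_cst; exact: derive1_cvg.
move/cvgrPdist_le : C => /(_ k k0) /nbhs_ballP[d /= d0 H].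
apply/nbhs_ballP; exists d => //= y ty.
have [->|yt] := eqVneq y t.
  by rewrite !subrr mul0r subrr normr0 mulr0.
have yt0 : y - t != 0 by rewrite subr_eq0.
have {}ty : ball 0 d (y - t) by rewrite /ball /= sub0r opprB.
have := H _ ty yt0.
rewrite subrK => Hk.
apply: le_trans (ler_wpM2r (normr_ge0 (y - t)) Hk); rewrite -normrM -normrN.

rewrite le_eqVlt; apply/orP; left; apply/eqP; congr `|_|.
rewrite /dot -![_ *: _]/(_ * _) /=; field.
exact: yt0.
Qed.

Lemma sign_perturb (D A B e : R) : D != 0 -> 0 < e ->
  `|A| <= `|D| / 4 * e -> `|B| <= `|D| / 4 * e -> 0 < D * (e * D + A + B).
Proof.
move=> D0 e0; rewrite !ler_norml => /andP[A1 A2] /andP[B1 B2].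
have [Dp|Dn] := ltP 0 D.
  rewrite gtr0_norm // in A1 A2 B1 B2; have De := mulr_gt0 Dp e0.
  by apply: mulr_gt0 => //; lra.
have {}Dn : D < 0 by rewrite lt_neqAle D0.
rewrite ltr0_norm // in A1 A2 B1 B2.
have De : D * e < 0 by rewrite pmulr_llt0.
by rewrite nmulr_rgt0 //; lra.
Qed.

Lemma ball_ends u e : 0 < e ->
  u - e <= u - e <= u + e /\ u - e <= u + e <= u + e.
Proof. by move=> e0; split; apply/andP; split; lra. Qed.

(** To first order [c y - v x] is a combination of the two velocities with coefficients [y - t] and
    [-(x - u)]. Along the boundary of a small square it therefore runs once around the origin, each
    side staying in an open half-plane. *)
Lemma crossing_square c v t u : derivable_curve c -> derivable_curve v ->
  c t = v u -> cross (velocity v u) (velocity c t) != 0 ->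
  \forall e \near 0^'+,
    turning c (t - e) (t + e) (v (u - e)) (+) turning c (t - e) (t + e) (v (u + e))
    (+) (winding (fun x => c (t - e) - v x) (u - e) (u + e)
    (+) winding (fun x => c (t + e) - v x) (u - e) (u + e)) = true.
Proof.
move=> dc dv ctvu; set V := velocity v u; set G := velocity c t.
set D := cross V G => D0.
(* [X] is orthogonal to [V] and [Y] to [G]: up to the factor [D] they read the coordinates in the
   basis of the two velocities. *)
pose X : R * R := (- V.2, V.1); pose Y : R * R := (G.2, - G.1).
(* Each of the two curves brings an error; with one quarter, their sum stays below the main term. *)
have k0 : 0 < `|D| / 4 by rewrite divr_gt0 // normr_gt0.
have /nbhs_ballP[d1 /= d10 H1] := dot_approx X t dc k0.
have /nbhs_ballP[d2 /= d20 H2] := dot_approx Y t dc k0.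
have /nbhs_ballP[d3 /= d30 H3] := dot_approx X u dv k0.
have /nbhs_ballP[d4 /= d40 H4] := dot_approx Y u dv k0.
have dXV : dot X V = 0 by rewrite /dot /X /=; ring.
have dXG : dot X G = D by rewrite /dot /X /D /cross /=; ring.
have dYV : dot Y V = D by rewrite /dot /Y /D /cross /=; ring.
have dYG : dot Y G = 0 by rewrite /dot /Y /=; ring.
rewrite -/G dXG in H1; rewrite -/G dYG in H2.
rewrite -/V dXV in H3; rewrite -/V dYV in H4.
near=> e.
have e0 : 0 < e by near: e; exact: nbhs_right_gt.
have e1 : e < d1 by near: e; exact: nbhs_right_lt.
have e2 : e < d2 by near: e; exact: nbhs_right_lt.
have e3 : e < d3 by near: e; exact: nbhs_right_lt.
have e4 : e < d4 by near: e; exact: nbhs_right_lt.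
have scale (z : R) : `|z| <= e -> `|D| / 4 * `|z| <= `|D| / 4 * e.
  by move=> ze; rewrite ler_wpM2l // ltW.
have dist (y z : R) : z - e <= y <= z + e -> `|y - z| <= e.
  by rewrite ler_distl => /andP[-> ->].
have A1 (y : R) : t - e <= y <= t + e ->
    `|dot X (c y) - dot X (c t) - (y - t) * D| <= `|D| / 4 * e.
  move/dist => ye; apply: le_trans (scale _ ye); apply: H1.
  by rewrite /ball /= distrC (le_lt_trans ye).
have A2 (y : R) : t - e <= y <= t + e ->
    `|dot Y (c y) - dot Y (c t)| <= `|D| / 4 * e.
  move/dist => ye; apply: le_trans (scale _ ye).
  rewrite -[_ - _]subr0 -(mulr0 (y - t)); apply: H2.
  by rewrite /ball /= distrC (le_lt_trans ye).
have A3 (y : R) : u - e <= y <= u + e ->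
    `|dot X (v u) - dot X (v y)| <= `|D| / 4 * e.
  move/dist => ye; apply: le_trans (scale _ ye).
  rewrite distrC -[_ - _]subr0 -(mulr0 (y - u)); apply: H3.
  by rewrite /ball /= distrC (le_lt_trans ye).
have A4 (y : R) : u - e <= y <= u + e ->
    `|dot Y (v u) - dot Y (v y) + (y - u) * D| <= `|D| / 4 * e.
  move/dist => ye; apply: le_trans (scale _ ye).
  rewrite -normrN opprD opprB; apply: H4.
  by rewrite /ball /= distrC (le_lt_trans ye).
have [lu ru] := ball_ends u e0.
have [lt rt] := ball_ends t e0.
have dotZB l z w : dot (D *: l) (z - w) = D * (dot l z - dot l w).
  by case: l => l1 l2; rewrite scale_pairE /dot /=; ring.
have dotNZB l z w : dot (- (D *: l)) (z - w) = D * (dot l w - dot l z).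
  by case: l => l1 l2; rewrite scale_pairE /dot /=; ring.
(* [B1] to [B4] place the images of the four sides of the square in half-planes. *)
have B1 (y : R) : t - e <= y <= t + e -> 0 < dot (D *: Y) (c y - v (u - e)).
  move=> yt; rewrite dotZB.
  have := sign_perturb D0 e0 (A2 y yt) (A4 _ lu); congr (_ < _ * _).
  by rewrite ctvu; ring.
have B2 (y : R) : t - e <= y <= t + e -> 0 < dot (- (D *: Y)) (c y - v (u + e)).
  move=> yt; rewrite dotNZB.
  have a := A2 y yt; have b := A4 _ ru; rewrite -normrN in a; rewrite -normrN in b.
  have := sign_perturb D0 e0 a b; congr (_ < _ * _).
  by rewrite ctvu; ring.
have B3 (x : R) : u - e <= x <= u + e -> 0 < dot (- (D *: X)) (c (t - e) - v x).
  move=> xu; rewrite dotNZB.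
  have a := A1 _ lt; have b := A3 x xu; rewrite -normrN in a; rewrite -normrN in b.
  have := sign_perturb D0 e0 a b; congr (_ < _ * _).
  by rewrite ctvu; ring.
have B4 (x : R) : u - e <= x <= u + e -> 0 < dot (D *: X) (c (t + e) - v x).
  move=> xu; rewrite dotZB.
  have := sign_perturb D0 e0 (A1 _ rt) (A3 x xu); congr (_ < _ * _).
  by rewrite ctvu; ring.
have let2 (z : R) : z - e <= z + e by have [/andP[]] := ball_ends z e0.
rewrite /turning (winding_half (let2 t) B1) (winding_half (let2 t) B2).
rewrite (winding_half (let2 u) B3) (winding_half (let2 u) B4).
have DX z : dot (D *: X) z = D * cross V z.
  by rewrite /X scale_pairE /dot /cross /=; ring.
have DY z : dot (D *: Y) z = D * cross z G.
  by rewrite /Y scale_pairE /dot /cross /=; ring.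
have DN l z : dot (- l) z = - dot l z by rewrite /dot /=; ring.
have := @ray_cross_square R V G (c (t - e) - v (u - e)) (c (t + e) - v (u - e))
  (c (t + e) - v (u + e)) (c (t - e) - v (u + e)) D0.
rewrite -/D -!DX -!DY.
rewrite B1 // B1 // B4 // B4 //.
have N l z : 0 < dot (- l) z -> dot l z < 0 by rewrite DN oppr_gt0.
rewrite !N ?B2 ?B3 //.
move=> /(_ isT isT isT isT isT isT isT isT) <-.
rewrite (ray_crossC (c (t - e) - v (u + e)) (c (t + e) - v (u + e))).
rewrite (ray_crossC (c (t - e) - v (u + e)) (c (t - e) - v (u - e))).
by do 4!move: (ray_cross _ _) => [].
Unshelve. all: by end_near.
Qed.


End Crossing.

(** * Counting transverse crossings in a rectangle of parameters *)

Section Rectangle.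
Local Open Scope classical_set_scope.
Local Open Scope ring_scope.
Variable R : realType.
Implicit Types (p q l : R * R) (a b t u d e : R) (c v : R -> R * R).

(** The strip is cut into three rectangles: the square of [crossing_square] around the crossing, and
    two others without crossings, to which [turning_sweep] applies. *)
Lemma turning_cross1 c v a b u t : derivable_curve c -> derivable_curve v ->
  a < t < b -> c t = v u -> cross (velocity v u) (velocity c t) != 0 ->
  \forall e \near 0^'+,
    (forall x y, u - e <= x <= u + e -> a <= y <= b -> c y = v x -> x = u /\ y = t) ->
    turning c a b (v (u - e)) (+) turning c a b (v (u + e))
    = winding (fun x => c a - v x) (u - e) (u + e)
      (+) winding (fun x => c b - v x) (u - e) (u + e) (+) true.
Proof.
move=> dc dv /andP[at_ tb] ctvu tr; near=> e => uniq.
have e0 : 0 < e by near: e; exact: nbhs_right_gt.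
have ea : e < t - a by near: e; apply: nbhs_right_lt; rewrite subr_gt0.
have eb : e < b - t by near: e; apply: nbhs_right_lt; rewrite subr_gt0.
have sq : turning c (t - e) (t + e) (v (u - e)) (+) turning c (t - e) (t + e) (v (u + e))
    (+) (winding (fun x => c (t - e) - v x) (u - e) (u + e)
    (+) winding (fun x => c (t + e) - v x) (u - e) (u + e)) = true.
  by near: e; exact: crossing_square.
have h1 : a <= t - e by rewrite lerBrDl -lerBrDr ltW.
have h2 : t + e <= b by rewrite -lerBrDl ltW.
have h3 : t - e <= t + e by have [/andP[]] := ball_ends t e0.
have [lu ru] := ball_ends u e0.
have uu : u - e <= u + e by case/andP: lu.
have Cc a' b' : continuous_on c a' b' by exact: derivable_curve_continuous.
have Cv a' b' : continuous_on v a' b' by exact: derivable_curve_continuous.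
have split3 x : u - e <= x <= u + e -> x != u ->
    turning c a b (v x) = turning c a (t - e) (v x)
      (+) turning c (t - e) (t + e) (v x) (+) turning c (t + e) b (v x).
  move=> xu xnu.
  have av y : a <= y <= b -> c y - v x != 0.
    move=> yab; rewrite subr_eq0; apply/eqP => /(uniq _ _ xu yab)[xE _].
    by rewrite xE eqxx in xnu.
  have C := continuous_on_subr (v x) (Cc a b).
  rewrite /turning (winding_cat (le_trans h1 h3) h2 C av).
  rewrite (winding_cat h1 h3 (sub_continuous_on (lexx a) h2 C)) //.
  by move=> y /andP[ay yte]; apply: av; rewrite ay (le_trans yte h2).
rewrite !split3 //; [|by rewrite -subr_eq0; lra.. ].
have sw1 : turning c a (t - e) (v (u - e)) (+) turning c a (t - e) (v (u + e))
    = winding (fun x => c a - v x) (u - e) (u + e)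
      (+) winding (fun x => c (t - e) - v x) (u - e) (u + e).
  apply: turning_sweep => // x xu y /andP[ay yt]; apply/eqP => cy.
  have [|_ E] := uniq _ _ xu _ cy; first by rewrite ay (le_trans yt) ?(le_trans h3).
  by rewrite E in yt; lra.
have sw2 : turning c (t + e) b (v (u - e)) (+) turning c (t + e) b (v (u + e))
    = winding (fun x => c (t + e) - v x) (u - e) (u + e)
      (+) winding (fun x => c b - v x) (u - e) (u + e).
  apply: turning_sweep => // x xu y /andP[ty yb]; apply/eqP => cy.
  have [|_ E] := uniq _ _ xu _ cy; first by rewrite yb (le_trans h1) ?(le_trans h3).
  by rewrite E in ty; lra.
rewrite addbACA [X in X (+) _]addbACA sw1 sw2; move: sq.
move: (turning _ _ _ _ (+) turning _ _ _ _).
move: (winding _ _ _) (winding _ _ _) (winding _ _ _) (winding _ _ _).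
by do 5!case.
Unshelve. all: by end_near.
Qed.

(** A mod 2 argument principle for [c y - v x] on a rectangle, by induction on the number of zeros:
    a thin strip around one of them is cut out. *)
Lemma turning_count (I : finType) (U T : I -> R) c v a b u d :
  derivable_curve c -> derivable_curve v -> injective U -> a <= b -> u <= d ->
  (forall k, c (T k) = v (U k)) ->
  (forall k, cross (velocity v (U k)) (velocity c (T k)) != 0) ->
  (forall x y, u <= x <= d -> a <= y <= b -> c y = v x ->
     exists k, x = U k /\ y = T k) ->
  avoids c a b (v u) -> avoids c a b (v d) ->
  avoids v u d (c a) -> avoids v u d (c b) ->
  turning c a b (v u) (+) turning c a b (v d)
  = winding (fun x => c a - v x) u d (+) winding (fun x => c b - v x) u d
    (+) odd #|[pred k | u < U k < d & a < T k < b]|.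
Proof.
move=> dc dv Uinj ab ud cT tr.
have [m] := ubnP #|[pred k | u < U k < d & a < T k < b]|.
have Cc a' b' : continuous_on c a' b' by exact: derivable_curve_continuous.
have Cv a' b' : continuous_on v a' b' by exact: derivable_curve_continuous.
elim: m u d ud => // m IH u d ud cm full avu avd ava avb.
(* The four sides carry no crossing, so a crossing in the closed rectangle is interior. *)
have inside x y k : u <= x <= d -> a <= y <= b -> x = U k -> y = T k ->
    (u < U k < d) && (a < T k < b).
  move=> /andP[ux xd] /andP[ay yb] xE yE; move: (cT k); rewrite -xE -yE => cv.
  rewrite !lt_neqAle ux xd ay yb !andbT.
  apply/and3P; split; first apply/andP; try split.
  - apply: contra (avu y _) => [/eqP->|]; first by rewrite cv.
    by rewrite ay.
  - apply: contra (avd y _) => [/eqP<-|]; first by rewrite cv.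
    by rewrite ay.
  - apply: contra (ava x _) => [/eqP->|]; first by rewrite cv.
    by rewrite ux.
  - apply: contra (avb x _) => [/eqP<-|]; first by rewrite cv.
    by rewrite ux.
case: (pickP [pred k | u < U k < d & a < T k < b]) => [k /= kin | none]; last first.
  rewrite (eq_card0 none) addbF; apply: turning_sweep => // x xud y yab.
  apply/eqP => /(full _ _ xud yab)[k [xE yE]].
  by have := none k; rewrite /= (inside _ _ _ xud yab xE yE).
set P := [pred k | _] in cm *.
have [/andP[uU Ud] /andP[aT Tb]] := andP kin.
have aTb : a < T k < b by rewrite aT.
have gap k' : k' != k -> \forall e \near (0 : R)^'+, e < `|U k' - U k|.
  move=> kk; apply: nbhs_right_lt; rewrite normr_gt0 subr_eq0.
  by apply: contra kk => /eqP/Uinj->.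
(* The strip of half-width [e] around [U k] stays inside the rectangle and contains no other
   [U k']. *)
have /filter_ex[e [e0 eu ed egap ecross]] : \forall e \near (0 : R)^'+,
    [/\ 0 < e, e < U k - u, e < d - U k,
        forall k', k' != k -> e < `|U k' - U k| &
    (forall x y, U k - e <= x <= U k + e -> a <= y <= b -> c y = v x ->
       x = U k /\ y = T k) ->
    turning c a b (v (U k - e)) (+) turning c a b (v (U k + e))
    = winding (fun x => c a - v x) (U k - e) (U k + e)
      (+) winding (fun x => c b - v x) (U k - e) (U k + e) (+) true].
  have gaps : \forall e \near (0 : R)^'+, forall k', k' != k -> e < `|U k' - U k|.
    apply: filter_forall => k'; have [->|kk] := eqVneq k' k.
      by apply: nearW.
    by near=> e => _; near: e; exact: gap.
  near=> e; split; last by near: e; exact: turning_cross1.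
  - by near: e; exact: nbhs_right_gt.
  - by near: e; apply: nbhs_right_lt; rewrite subr_gt0.
  - by near: e; apply: nbhs_right_lt; rewrite subr_gt0.
  - by near: e.
have ul : u < U k - e by rewrite ltrBrDl -ltrBrDr.
have rd : U k + e < d by rewrite -ltrBrDl.
have [lU Ur] : U k - e < U k /\ U k < U k + e by rewrite ltrBlDr ltrDl.
have only k' : U k - e <= U k' <= U k + e -> k' = k.
  move=> h; apply/eqP; apply: contraT => /egap; rewrite ltNge.
  by rewrite ler_distl h.
have fullin x y : U k - e <= x <= U k + e -> a <= y <= b -> c y = v x ->
    x = U k /\ y = T k.
  move=> /andP[h1 h2] yab cy.
  have [|k' [xE yE]] := full x y _ yab cy.
    by rewrite (le_trans (ltW ul) h1) (le_trans h2 (ltW rd)).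
  by rewrite xE yE (only k') // -xE h1.
have {}ecross := ecross fullin.
have sub_full u' d' : u <= u' -> d' <= d -> forall x y, u' <= x <= d' ->
    a <= y <= b -> c y = v x -> exists k, x = U k /\ y = T k.
  move=> h1 h2 x y /andP[h3 h4]; apply: full.
  by rewrite (le_trans h1 h3) (le_trans h4 h2).
have sub_av u' d' p : u <= u' -> d' <= d -> avoids v u d p -> avoids v u' d' p.
  by move=> h1 h2 h x /andP[h3 h4]; apply: h; rewrite (le_trans h1 h3) (le_trans h4 h2).
have avl : avoids c a b (v (U k - e)).
  move=> y yab; apply/eqP => cy.
  have [|E _] := fullin _ _ _ yab cy; first by rewrite lexx (ltW (lt_trans lU Ur)).
  by move: lU; rewrite E ltxx.
have avr : avoids c a b (v (U k + e)).
  move=> y yab; apply/eqP => cy.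
  have [|E _] := fullin _ _ _ yab cy; first by rewrite lexx (ltW (lt_trans lU Ur)).
  by move: Ur; rewrite E ltxx.
pose L := [pred k' | u < U k' < U k - e & a < T k' < b].
pose Q := [pred k' | U k + e < U k' < d & a < T k' < b].
(* A crossing is before the strip, is [k] itself, or is after the strip. *)
have card : #|P| = (#|L| + #|pred1 k| + #|Q|)%N.
  have cardE (A : pred I) : #|A| = (\sum_k' (k' \in A : nat))%N.
    by rewrite -sum1_card big_mkcond; apply: eq_bigr => k' _; case: (k' \in A).
  rewrite !cardE -!big_split /=.
  apply: eq_bigr => k' _; rewrite /P /L /Q !inE /=.
  have [->|kk] := eqVneq k' k.
    by rewrite uU Ud aTb (lt_gtF lU) (lt_gtF Ur) andbF.
  have := egap _ kk; rewrite ltNge ler_distl negb_and -!ltNge.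
  case: (a < T k' < b); rewrite ?andbF ?andbT //.
  case/orP => h.
    rewrite h (lt_trans h (lt_trans lU Ud)) (lt_gtF (lt_trans h (lt_trans lU Ur))).
    by case: (u < U k').
  rewrite h (lt_trans (lt_trans uU Ur) h) (lt_gtF (lt_trans (lt_trans lU Ur) h)).
  by rewrite andbF; case: (U k' < d).
rewrite card1 in card.
have cLQ : (#|L| + #|Q| < m)%N by move: cm; rewrite card addn1 addSn.
have cL := leq_ltn_trans (leq_addr _ _) cLQ.
have cQ := leq_ltn_trans (leq_addl _ _) cLQ.
have rd' := ltW rd; have ul' := ltW ul.
have := IH _ _ ul' cL (sub_full _ _ (lexx u) (ltW (lt_trans lU Ud))) avu avl
  (sub_av _ _ _ (lexx u) (ltW (lt_trans lU Ud)) ava)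
  (sub_av _ _ _ (lexx u) (ltW (lt_trans lU Ud)) avb).
have := IH _ _ rd' cQ (sub_full _ _ (ltW (lt_trans uU Ur)) (lexx d)) avr avd
  (sub_av _ _ _ (ltW (lt_trans uU Ur)) (lexx d) ava)
  (sub_av _ _ _ (ltW (lt_trans uU Ur)) (lexx d) avb).
have wsplit p : avoids v u d p -> winding (fun x => p - v x) u d =
    winding (fun x => p - v x) u (U k - e)
    (+) winding (fun x => p - v x) (U k - e) (U k + e)
    (+) winding (fun x => p - v x) (U k + e) d.
  move=> av.
  have v0 x : u <= x <= d -> p - v x != 0.
    by move=> xud; rewrite subr_eq0 eq_sym av.
  have C := continuous_on_subl p (Cv u d).
  rewrite (winding_cat (ltW (lt_trans uU Ur)) rd' C v0).
  have C' := sub_continuous_on (lexx u) rd' C.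
  have v0' x : u <= x <= U k + e -> p - v x != 0.
    by move=> /andP[h1 h2]; apply: v0; rewrite h1 (le_trans h2 rd').
  by rewrite (winding_cat ul' (ltW (lt_trans lU Ur)) C' v0').
rewrite (wsplit _ ava) (wsplit _ avb) card !oddD /=; move: ecross.
move: (odd #|L|) (odd #|Q|) => oL oQ.
set w1 := winding _ _ _; set w2 := winding _ _ _.
set w3 := winding _ _ _; set w4 := winding _ _ _.
set w5 := winding _ _ _; set w6 := winding _ _ _ => E1 E2 E3.
rewrite -(addbK (turning c a b (v (U k - e))) (turning c a b (v u))) E3.
rewrite -(addbK (turning c a b (v (U k + e))) (turning c a b (v (U k - e)))) E1.
rewrite -!addbA E2.
clear E1 E2 E3; by move: w1 w2 w3 w4 w5 w6 oL oQ; do 8!case.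
Unshelve. all: by end_near.
Qed.

End Rectangle.

(** * Loops with a corner *)

Section Corner.
Local Open Scope classical_set_scope.
Local Open Scope ring_scope.
Variable R : realType.
Implicit Types (p q l o : R * R) (a b t u d e m r x y : R) (c v w z : R -> R * R).

Lemma near_left (P : R -> Prop) u : (\forall y \near u, P y) ->
  \forall e \near 0^'+, P (u - e).
Proof.
move=> /nbhs_ballP[d /= d0 H]; near=> e; apply: H.
have e0 : 0 < e by near: e; exact: nbhs_right_gt.
have ed : e < d by near: e; exact: nbhs_right_lt.
by rewrite /ball /= opprB addrC subrK gtr0_norm.
Unshelve. all: by end_near.
Qed.

Lemma velocity_side l c u : derivable_curve c -> 0 < dot l (velocity c u) ->
  \forall y \near u, (u < y -> dot l (c u) < dot l (c y)) /\
                     (y < u -> dot l (c y) < dot l (c u)).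
Proof.
move=> dc; set k := dot l _ => k0; have k2 : 0 < k / 2 by rewrite divr_gt0.
near=> y.
have : `|dot l (c y) - dot l (c u) - (y - u) * k| <= k / 2 * `|y - u|.
  by near: y; exact: dot_approx.
rewrite ler_norml => /andP[h1 h2]; split => yu.
  rewrite gtr0_norm ?subr_gt0 // in h1 h2.
  have : 0 < k * (y - u) by rewrite mulr_gt0 // subr_gt0.
  lra.
rewrite ltr0_norm ?subr_lt0 // in h1 h2.
have : 0 < k * (u - y) by rewrite mulr_gt0 // subr_gt0.
lra.
Unshelve. all: by end_near.
Qed.

Lemma avoids_near c a b p : continuous_on c a b -> avoids c a b p ->
  exists2 m, 0 < m & forall q, dot (q - p) (q - p) < m -> avoids c a b q.
Proof.
move=> C av; have [ab|ba] := leP a b.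
  by have [m m0 H] := turning_near ab C av; exists m => // q /H[].
by exists 1 => // q _ t /andP[h1 h2]; have := le_lt_trans (le_trans h1 h2) ba; rewrite ltxx.
Qed.

(** Just after [u] the form [l] increases along [c], which excludes points with a smaller value; the
    rest of the branch keeps a positive distance from [c u]. *)
Lemma avoids_behind l c u b : derivable_curve c -> 0 < dot l (velocity c u) ->
  (forall y, u < y <= b -> c y != c u) ->
  exists2 m, 0 < m & forall q, dot (q - c u) (q - c u) < m ->
    dot l q < dot l (c u) -> avoids c u b q.
Proof.
move=> dc lc inj.
have /nbhs_ballP[d /= d0 H] := velocity_side dc lc.
have [m m0 Hm] : exists2 m, 0 < m & forall q, dot (q - c u) (q - c u) < m ->
    avoids c (u + d) b q.
  apply: avoids_near; first exact: derivable_curve_continuous.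
  move=> y /andP[h1 h2]; apply: inj; rewrite h2 (lt_le_trans _ h1) //.
  by rewrite ltrDl.
exists m => // q qm lq t /andP[ut tb].
have [td|td] := leP (u + d) t; first by apply: (Hm _ qm); rewrite td.
apply: contraTneq lq => <-; rewrite -leNgt.
move: ut; rewrite le_eqVlt => /predU1P[-> // | ut].
have [|/(_ ut)/ltW //] := H t.
by rewrite /ball /= distrC gtr0_norm ?subr_gt0 // ltrBlDl.
Qed.

Lemma dot_convex p q x : 0 <= x <= 1 ->
  dot (p + x *: (q - p)) (p + x *: (q - p)) <= (1 - x) * dot p p + x * dot q q.
Proof.
move=> /andP[x0 x1]; rewrite -subr_ge0.
have -> : (1 - x) * dot p p + x * dot q q
    - dot (p + x *: (q - p)) (p + x *: (q - p)) =
    x * (1 - x) * (((p - q).1) ^+ 2 + ((p - q).2) ^+ 2).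
  by case: p q => [a b] [a' b']; rewrite /dot /= -![_ *: _]/(_ * _); ring.
by rewrite mulr_ge0 ?addr_ge0 ?sqr_ge0 // mulr_ge0 // subr_ge0.
Qed.

Lemma convex_lt (A B m x : R) : 0 <= x <= 1 -> A < m -> B < m ->
  (1 - x) * A + x * B < m.
Proof.
move=> /andP[x0 x1] Am Bm.
have : 0 <= (1 - x) * (m - A) by rewrite mulr_ge0 ?subr_ge0 // ltW.
have : 0 <= x * (m - B) by rewrite mulr_ge0 // subr_ge0 ltW.
move: x0; rewrite le_eqVlt => /predU1P[<- | x0]; first by lra.
have : 0 < x * (m - B) by rewrite mulr_gt0 // subr_gt0.
lra.
Qed.

Definition segment p q x : R * R := p + x *: (q - p).

Lemma segment_continuous p q a b : continuous_on (segment p q) a b.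
Proof.
move=> t _; split; apply: cvgD; try exact: cvg_cst.
  by apply: cvgM; [exact: cvg_id | exact: cvg_cst].
by apply: cvgM; [exact: cvg_id | exact: cvg_cst].
Qed.

(* On both sides of the corner the linear form [l] increases along the curves,
   so it separates the segment from the outgoing branches. *)
Lemma corner_segment v w z u t b d : derivable_curve v -> derivable_curve w ->
  continuous_on z 0 1 -> v u = w t -> cross (velocity v u) (velocity w t) != 0 ->
  (forall y, u < y <= b -> v y != v u) -> (forall y, t < y <= d -> w y != w t) ->
  avoids z 0 1 (v u) ->
  \forall e \near 0^'+, forall x, 0 <= x <= 1 ->
    let q := segment (v (u - e)) (w (t - e)) x in
    [/\ avoids v u b q, avoids w t d q & avoids z 0 1 q].
Proof.
move=> dv dw Cz vw; set V := velocity v u; set W := velocity w t.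
set D := cross V W => D0 injv injw avz.
have D2 : 0 < D * D by rewrite -expr2 exprn_even_gt0.
(* This form takes the same positive value [D * D] on both velocities. *)
pose l : R * R := D *: (W.2 - V.2, V.1 - W.1).
have lV : 0 < dot l V.
  suff -> : dot l V = D * D by [].
  by rewrite /l scale_pairE /dot /D /cross /=; ring.
have lW : 0 < dot l W.
  suff -> : dot l W = D * D by [].
  by rewrite /l scale_pairE /dot /D /cross /=; ring.
have [m1 m10 H1] := avoids_behind dv lV injv.
have [m2 m20 H2] := avoids_behind dw lW injw.
have [m3 m30 H3] := avoids_near Cz avz.
pose m := Num.min m1 (Num.min m2 m3).
have m0 : 0 < m by rewrite !lt_min m10 m20.
have uu : u <= u <= u by rewrite lexx.
have tt : t <= t <= t by rewrite lexx.
near=> e.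
have e0 : 0 < e by near: e; exact: nbhs_right_gt.
have sv : (u < u - e -> dot l (v u) < dot l (v (u - e))) /\
          (u - e < u -> dot l (v (u - e)) < dot l (v u)).
  by near: e; apply: (near_left (velocity_side dv lV)).
have sw : (t < t - e -> dot l (w t) < dot l (w (t - e))) /\
          (t - e < t -> dot l (w (t - e)) < dot l (w t)).
  by near: e; apply: (near_left (velocity_side dw lW)).
have nv : dot (v (u - e) - v u) (v (u - e) - v u) < m.
  by near: e; apply: (near_left (near_dist (derivable_curve_continuous dv) uu m0)).
have nw : dot (w (t - e) - w t) (w (t - e) - w t) < m.
  by near: e; apply: (near_left (near_dist (derivable_curve_continuous dw) tt m0)).
move: sv sw; rewrite !ltrBlDr !ltrDl e0 -vw => -[_ /(_ isT) sv] [_ /(_ isT) sw].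
move=> x x01 /=; set q := segment _ _ _.
have lq : dot l q < dot l (v u).
  have -> : dot l q = (1 - x) * dot l (v (u - e)) + x * dot l (w (t - e)).
    by rewrite /q /segment /dot /= -![_ *: _]/(_ * _); ring.
  exact: convex_lt.
have : dot (q - v u) (q - v u) < m.
  have -> : q - v u = (v (u - e) - v u) + x *: ((w (t - e) - v u) - (v (u - e) - v u)).
    by rewrite /q /segment opprB addrA subrK addrAC.
  apply: le_lt_trans (dot_convex _ _ x01) _; apply: convex_lt => //.
  by rewrite [v u]vw.
rewrite !lt_min => /and3P[qm1 qm2 qm3].
by split; [exact: H1 | apply: H2; rewrite -vw | exact: H3].
Unshelve. all: by end_near.
Qed.

End Corner.

(** * The loop at a crossing and the two branches that come into its corner *)

Section CornerParity.
Local Open Scope classical_set_scope.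
Local Open Scope ring_scope.
Variable R : realType.
Implicit Types (p q l o : R * R) (a b t u d e m r x y : R) (c v w z : R -> R * R).

(** What the parity argument keeps of a meander: crossing [k] has parameter [U k] on [v] and [T k]
    on [w]. This form is symmetric in the two curves and stable under reversing one of them. *)
Record arrangement (I : finType) o r v w (U T : I -> R) : Prop := Arrangement {
  arr_derv : derivable_curve v;
  arr_derw : derivable_curve w;
  arr_injv : forall x y, 0 <= x <= 1 -> 0 <= y <= 1 -> v x = v y -> x = y;
  arr_injw : forall x y, 0 <= x <= 1 -> 0 <= y <= 1 -> w x = w y -> x = y;
  arr_diskv : forall x, 0 <= x <= 1 -> disk o r (v x);
  arr_diskw : forall x, 0 <= x <= 1 -> disk o r (w x);
  arr_endsv : disk_boundary o r (v 0) /\ disk_boundary o r (v 1);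
  arr_endsw : disk_boundary o r (w 0) /\ disk_boundary o r (w 1);
  arr_U : forall k, 0 < U k < 1;
  arr_T : forall k, 0 < T k < 1;
  arr_Uinj : injective U;
  arr_Tinj : injective T;
  arr_cross : forall k, w (T k) = v (U k);
  arr_full : forall x y, 0 <= x <= 1 -> 0 <= y <= 1 -> w y = v x ->
    exists k, x = U k /\ y = T k;
  arr_transverse : forall k, cross (velocity v (U k)) (velocity w (T k)) != 0
}.

Lemma arrangementC (I : finType) o r v w (U T : I -> R) :
  arrangement o r v w U T -> arrangement o r w v T U.
Proof.
case=> dv dw iv iw kv kw ev ew hU hT Ui Ti cr fu tr; split => //.
  by move=> x y xi yi E; have [k [-> ->]] := fu y x yi xi (esym E); exists k.
move=> k; have -> : cross (velocity w (T k)) (velocity v (U k)) =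
  - cross (velocity v (U k)) (velocity w (T k)) by rewrite /cross; ring.
by rewrite oppr_eq0.
Qed.

(** Strict convexity: away from [p], the disk lies in the open half-plane bounded by the tangent at
    [p]. *)
Lemma disk_half_plane o r p q : disk_boundary o r p -> disk o r q -> q != p ->
  0 < dot (o - p) (q - p).
Proof.
rewrite /disk_boundary /disk /dist2 /= => hp hq; rewrite -subr_eq0 => /dot_gt0.
by move: hp hq; rewrite /dot /=; lra.
Qed.

Lemma turning_boundary c a b o r p : a <= b -> disk_boundary o r p ->
  (forall t, a <= t <= b -> disk o r (c t)) -> avoids c a b p ->
  turning c a b p = ray_cross (c a - p) (c b - p).
Proof.
move=> ab hp kc av; apply: winding_half (ab) _ => t tab.
by apply: (disk_half_plane hp); [exact: kc | exact: av].
Qed.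

(** When [v u = w t] and [z] joins [v b] to [w d], this is the mod 2 winding number around [p] of
    the loop formed by the two branches and [z]. Orientations do not matter modulo 2. *)
Definition loop_turning v w z u b t d p : bool :=
  turning v u b p (+) turning w t d p (+) turning z 0 1 p.

(** Seen from a boundary point the loop stays in a half-plane, so it does not turn. Both directions
    of [z] are allowed, so that [v] and [w] can be exchanged. *)
Lemma loop_boundary v w z u b t d o r p : u <= b -> t <= d ->
  v u = w t -> (z 0 = v b /\ z 1 = w d) \/ (z 0 = w d /\ z 1 = v b) ->
  disk_boundary o r p -> (forall x, u <= x <= b -> disk o r (v x)) ->
  (forall x, t <= x <= d -> disk o r (w x)) ->
  (forall x, 0 <= x <= 1 -> disk o r (z x)) ->
  avoids v u b p -> avoids w t d p -> avoids z 0 1 p ->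
  loop_turning v w z u b t d p = false.
Proof.
move=> ub td vw zE hp kv kw kz av aw az.
have ends x y : x <= y -> x <= x <= y /\ x <= y <= y by move=> xy; rewrite !lexx xy.
have [uub ubb] := ends _ _ ub; have [ttd tdd] := ends _ _ td.
have hb := disk_half_plane hp (kv b ubb) (av b ubb).
have hu := disk_half_plane hp (kv u uub) (av u uub).
have hd := disk_half_plane hp (kw d tdd) (aw d tdd).
rewrite /loop_turning !(@turning_boundary _ _ _ o r) //.
rewrite -vw (ray_cross_half hu hd hb).
rewrite addbA addbb addFb.
by case: zE => -[-> ->]; rewrite ?addbb // ray_crossC addbb.
Qed.

(** The endpoint terms of the three sweeps cancel because the loop is closed. *)
Lemma loop_sweep v w z u b t d s x y : u <= b -> t <= d -> x <= y ->
  v u = w t -> (z 0 = v b /\ z 1 = w d) \/ (z 0 = w d /\ z 1 = v b) ->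
  continuous_on v u b -> continuous_on w t d -> continuous_on z 0 1 ->
  continuous_on s x y ->
  (forall a, x <= a <= y ->
    [/\ avoids v u b (s a), avoids w t d (s a) & avoids z 0 1 (s a)]) ->
  loop_turning v w z u b t d (s x) = loop_turning v w z u b t d (s y).
Proof.
move=> ub td xy vw zE Cv Cw Cz Cs av; apply/eqP; rewrite -negb_add.
rewrite /loop_turning addbACA [X in X (+) _]addbACA.
rewrite !turning_sweep //; try by move=> a /av [].
rewrite -vw; case: zE => -[-> ->].
  by case: (winding _ _ _) (winding _ _ _) (winding _ _ _) => [] [] [].
by case: (winding _ _ _) (winding _ _ _) (winding _ _ _) => [] [] [].
Qed.

(** The incoming branch of [v] starts on the boundary, where the loop does not turn. It meets
    neither the outgoing branch of [v], by injectivity, nor [z]; each crossing with the outgoing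
    branch of [w] changes the parity. *)
Lemma loop_tail (I : finType) o r v w (U T : I -> R) z i b d :
  arrangement o r v w U T -> U i < b <= 1 -> T i < d <= 1 ->
  continuous_on z 0 1 -> (forall x, 0 <= x <= 1 -> disk o r (z x)) ->
  (z 0 = v b /\ z 1 = w d) \/ (z 0 = w d /\ z 1 = v b) ->
  (forall x, 0 <= x <= U i -> avoids z 0 1 (v x)) ->
  \forall e \near 0^'+, loop_turning v w z (U i) b (T i) d (v (U i - e))
    = odd #|[pred k | U k < U i & T i < T k < d]|.
Proof.
move=> arr /andP[Ub b1] /andP[Td d1] Cz kz zE avz.
case: (arr) => dv dw iv iw kv kw [ev _] _ hU hT Ui Ti cr fu tr.
have /andP[U0 U1] := hU i; have /andP[T0 T1] := hT i.
have Cv a' b' : continuous_on v a' b' by exact: derivable_curve_continuous.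
(* For small [e], every crossing before [i] on [v] is already before [U i - e]. *)
have gap : \forall e \near (0 : R)^'+, forall k, U k < U i -> U k < U i - e.
  apply: filter_forall => k; have [Uk|Uk] := ltP (U k) (U i); last first.
    by near=> e.
  near=> e => _; rewrite ltrBrDl -ltrBrDr; near: e.
  by apply: nbhs_right_lt; rewrite subr_gt0.
near=> e.
have e0 : 0 < e by near: e; exact: nbhs_right_gt.
have eU : e < U i by near: e; exact: nbhs_right_lt.
have ge : forall k, U k < U i -> U k < U i - e by near: e.
set y := U i - e.
have y0 : 0 <= y by rewrite subr_ge0 ltW.
have yU : y < U i by rewrite ltrBlDr ltrDl.
have v_av x : 0 <= x <= y -> avoids v (U i) b (v x).
  move=> /andP[x0 xy] t /andP[Ut tb]; apply/eqP => E.
  have tx : t = x.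
    apply: iv => //; first by rewrite (le_trans (ltW U0) Ut) (le_trans tb b1).
    by rewrite x0 (le_trans xy) // ltW // (lt_trans yU).
  by move: (le_lt_trans xy yU); rewrite -tx ltNge Ut.
have x01 x : 0 <= x <= y -> 0 <= x <= 1.
  by move=> /andP[-> xy]; rewrite (le_trans xy) // ltW // (lt_trans yU).
have z_av x : 0 <= x <= y -> avoids z 0 1 (v x).
  by move=> /andP[x0 xy]; apply: avz; rewrite x0 (le_trans xy) // ltW.
have t01 t : T i <= t <= d -> 0 <= t <= 1.
  by move=> /andP[Tt td]; rewrite (le_trans (ltW T0)) // (le_trans td).
have full x t : 0 <= x <= y -> T i <= t <= d -> w t = v x ->
    exists k, x = U k /\ t = T k.
  by move=> xy tT; apply: fu; [exact: x01 | exact: t01].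
have wd : w d = z 0 \/ w d = z 1 by case: zE => -[-> ->]; [right | left].
have vw_d : avoids v 0 y (w d).
  move=> x xy; apply/eqP => E; case: wd => wdE; move: E; rewrite wdE.
    by apply/eqP; rewrite eq_sym; apply: z_av; rewrite // ?lexx ?ler01.
  by apply/eqP; rewrite eq_sym; apply: z_av; rewrite // ?lexx ?ler01.
have v_avi : avoids v 0 y (w (T i)).
  move=> x xy; rewrite cr eq_sym; apply: v_av => //.
  by rewrite lexx ltW.
have yy : 0 <= y <= y by rewrite y0 lexx.
have oo : 0 <= (0 : R) <= y by apply/andP.
have w_av0 : avoids w (T i) d (v 0).
  move=> t tT; apply/eqP => /(full _ _ oo tT)[k [kE _]].
  by have := hU k; rewrite -kE ltxx.
have w_avy : avoids w (T i) d (v y).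
  move=> t tT; apply/eqP => /(full _ _ yy tT)[k [kE _]].
  by have := ge k; rewrite -kE yU ltxx => /(_ isT).
have := turning_count dw dv Ui (ltW Td) y0 cr tr full w_av0 w_avy v_avi vw_d.
have := turning_sweep (ltW Ub) y0 (Cv _ _) (Cv 0 y) v_av.
have := turning_sweep ler01 y0 Cz (Cv 0 y) z_av.
have card : #|[pred k | 0 < U k < y & T i < T k < d]| =
            #|[pred k | U k < U i & T i < T k < d]|.
  apply: eq_card => k; rewrite !inE; congr (_ && _).
  have /andP[-> _] := hU k; apply/idP/idP => [h|/ge //]; exact: lt_trans h yU.
rewrite card => {card}.
have := @loop_boundary v w z (U i) b (T i) d o r (v 0) (ltW Ub) (ltW Td)
  (esym (cr i)) zE ev _ _ kz (v_av _ oo) w_av0 (z_av _ oo).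
have kv' x : U i <= x <= b -> disk o r (v x).
  by move=> /andP[h1 h2]; apply: kv; rewrite (le_trans (ltW U0)) // (le_trans h2).
have kw' x : T i <= x <= d -> disk o r (w x).
  by move=> /t01; apply: kw.
move=> /(_ kv' kw') B S1 S2 S3; rewrite -[LHS]addFb -B.
rewrite /loop_turning addbACA [X in X (+) _]addbACA S1 S2 S3 cr.
move: (odd _) => N; case: zE => -[-> ->];
  move: (winding _ _ _) (winding _ _ _) (winding _ _ _) => p1 p2 p3.
  by move: p1 p2 p3 N => [] [] [] [].
by move: p1 p2 p3 N => [] [] [] [].
Unshelve. all: by end_near.
Qed.

(** By [loop_tail], each side is the turning of the loop around a point of an incoming branch just
    before the corner. The segment between these two points avoids the loop, so the turnings
    agree. *)
Lemma corner_parity (I : finType) o r v w (U T : I -> R) z i b d :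
  arrangement o r v w U T -> U i < b <= 1 -> T i < d <= 1 ->
  continuous_on z 0 1 -> (forall x, 0 <= x <= 1 -> disk o r (z x)) ->
  z 0 = v b -> z 1 = w d ->
  (forall x, 0 <= x <= U i -> avoids z 0 1 (v x)) ->
  (forall x, 0 <= x <= T i -> avoids z 0 1 (w x)) ->
  odd #|[pred k | U k < U i & T i < T k < d]|
  = odd #|[pred k | T k < T i & U i < U k < b]|.
Proof.
move=> arr Ub Td Cz kz z0 z1 avv avw.
have tail1 := loop_tail arr Ub Td Cz kz (or_introl (conj z0 z1)) avv.
have tail2 := loop_tail (arrangementC arr) Td Ub Cz kz (or_intror (conj z0 z1)) avw.
case: (arr) => dv dw iv iw kv kw _ _ hU hT Ui Ti cr fu tr.
have /andP[U0 U1] := hU i; have /andP[T0 T1] := hT i.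
move: Ub Td => /andP[Ub b1] /andP[Td d1].
have injv y : U i < y <= b -> v y != v (U i).
  move=> /andP[Uy yb]; apply/eqP => /iv E; move: (Uy); rewrite E ?ltxx //.
    by rewrite (le_trans yb b1) (le_trans (ltW U0) (ltW Uy)).
  by rewrite !ltW.
have injw y : T i < y <= d -> w y != w (T i).
  move=> /andP[Ty yd]; apply/eqP => /iw E; move: (Ty); rewrite E ?ltxx //.
    by rewrite (le_trans yd d1) (le_trans (ltW T0) (ltW Ty)).
  by rewrite !ltW.
have avz : avoids z 0 1 (v (U i)) by apply: avv; rewrite lexx ltW.
have Cv a' b' : continuous_on v a' b' by exact: derivable_curve_continuous.
have Cw a' b' : continuous_on w a' b' by exact: derivable_curve_continuous.
have seg := corner_segment dv dw Cz (esym (cr i)) (tr i) injv injw avz.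
suff : \forall e \near (0 : R)^'+, odd #|[pred k | U k < U i & T i < T k < d]|
  = odd #|[pred k | T k < T i & U i < U k < b]| by move=> /filter_ex[].
near=> e.
have <- : loop_turning v w z (U i) b (T i) d (v (U i - e))
  = odd #|[pred k | U k < U i & T i < T k < d]| by near: e.
have <- : loop_turning w v z (T i) d (U i) b (w (T i - e))
  = odd #|[pred k | T k < T i & U i < U k < b]| by near: e.
have sege : forall x, 0 <= x <= 1 ->
    let q := segment (v (U i - e)) (w (T i - e)) x in
    [/\ avoids v (U i) b q, avoids w (T i) d q & avoids z 0 1 q] by near: e.
have := loop_sweep (ltW Ub) (ltW Td) ler01 (esym (cr i)) (or_introl (conj z0 z1))
  (Cv _ _) (Cw _ _) Cz (@segment_continuous _ _ _ 0 1) sege.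
rewrite /segment scale0r addr0 scale1r subrKC => ->.
by rewrite /loop_turning [X in X (+) _]addbC.
Unshelve. all: by end_near.
Qed.

End CornerParity.

(** * Parity relations between crossings *)

Section Relations.
Local Open Scope classical_set_scope.
Local Open Scope ring_scope.
Variable R : realType.
Implicit Types (p q l o s : R * R) (a b t u d e m r x y : R) (c v w z : R -> R * R).

Definition reverse c : R -> R * R := fun x => c (1 - x).

Lemma derive1_reverse (f : R -> R) x : derivable f (1 - x) 1 ->
  derivable (fun y => f (1 - y)) x 1 /\
  derive1 (fun y => f (1 - y)) x = - derive1 f (1 - x).
Proof.
move=> df.
have g1 : is_derive x (1 : R) (fun y : R => 1 - y) (- 1).
  by rewrite -[X in is_derive _ _ _ X]add0r; apply: is_deriveB.
have dg : derivable (fun y : R => 1 - y) x 1 by exact: ex_derive.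
split.
  apply/derivable1_diffP.
  exact: (differentiable_comp ((derivable1_diffP _ _).1 dg) ((derivable1_diffP _ _).1 df)).
rewrite (derive1_comp dg df) mulrC derive1E.
by rewrite (@derive_val _ _ _ _ _ _ _ g1) mulN1r.
Qed.

Lemma reverse_derivable c : derivable_curve c -> derivable_curve (reverse c).
Proof.
move=> dc x; have [d1 d2] := dc (1 - x).
by split; [case: (derive1_reverse d1) | case: (derive1_reverse d2)].
Qed.

Lemma reverse_velocity c x : derivable_curve c ->
  velocity (reverse c) x = - velocity c (1 - x).
Proof.
move=> dc; have [d1 d2] := dc (1 - x).
rewrite /velocity; congr pair.
  exact: (derive1_reverse d1).2.
exact: (derive1_reverse d2).2.
Qed.

Lemma arrangement_reverse (I : finType) o r v w (U T : I -> R) :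
  arrangement o r v w U T ->
  arrangement o r (reverse v) w (fun k => 1 - U k) T.
Proof.
have rev x : 0 <= x <= 1 -> 0 <= 1 - x <= 1.
  by move=> /andP[x0 x1]; rewrite subr_ge0 x1 gerBl.
case=> dv dw iv iw kv kw [e0 e1] ew hU hT Ui Ti cr fu tr.
apply: Arrangement; [exact: reverse_derivable | exact: dw | | exact: iw | |
  exact: kw | | exact: ew | | exact: hT | | exact: Ti | | | ].
- by move=> x y /rev xi /rev yi /(iv _ _ xi yi) /subrI.
- by move=> x /rev /kv.
- by rewrite /reverse subr0 subrr.
- by move=> k; have /andP[U0 U1] := hU k; rewrite subr_gt0 U1 gtrBl.
- by move=> k k' /subrI /Ui.
- by move=> k; rewrite /reverse subKr.
- move=> x y /rev xi yi E; have [k [xE yE]] := fu _ _ xi yi E.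
  by exists k; rewrite -xE subKr.
move=> k; rewrite reverse_velocity // subKr.
have -> : cross (- velocity v (U k)) (velocity w (T k)) =
  - cross (velocity v (U k)) (velocity w (T k)) by rewrite /cross /=; ring.
by rewrite oppr_eq0.
Qed.

(** The loop leaves crossing [i] along both curves and closes up at crossing [j], so the joining
    path is constant. *)
Lemma parity_aligned (I : finType) o r v w (U T : I -> R) i j :
  arrangement o r v w U T -> U i < U j -> T i < T j ->
  odd #|[pred k | U k < U i & T i < T k < T j]|
  = odd #|[pred k | T k < T i & U i < U k < U j]|.
Proof.
move=> arr Uij Tij; have /andP[Uj0 Uj1] := arr_U arr j.
have /andP[Tj0 Tj1] := arr_T arr j.
have Uj : 0 <= U j <= 1 by rewrite !ltW.
have Tj : 0 <= T j <= 1 by rewrite !ltW.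
have Cz : continuous_on (fun=> v (U j)) 0 1 by move=> x _; split; exact: cvg_cst.
apply: (corner_parity arr _ _ Cz).
- by rewrite Uij ltW.
- by rewrite Tij ltW.
- by move=> x _; apply: (arr_diskv arr).
- by [].
- by rewrite (arr_cross arr).
- move=> x /andP[x0 xU] y _; apply/eqP => /(arr_injv arr Uj) E.
  move: (le_lt_trans xU Uij); rewrite -E ?ltxx //.
  by rewrite x0 (le_trans xU) // ltW // (lt_trans Uij).
move=> x /andP[x0 xT] y _; rewrite -(arr_cross arr); apply/eqP => /(arr_injw arr Tj) E.
move: (le_lt_trans xT Tij); rewrite -E ?ltxx //.
by rewrite x0 (le_trans xT) // ltW // (lt_trans Tij).
Qed.

(** Reversing [v] makes the pair aligned, with the corner at [j]. *)
Lemma parity_inverted (I : finType) o r v w (U T : I -> R) i j :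
  arrangement o r v w U T -> U i < U j -> T j < T i ->
  odd #|[pred k | U j < U k & T j < T k < T i]|
  = odd #|[pred k | T k < T j & U i < U k < U j]|.
Proof.
move=> /arrangement_reverse arr Uij Tji.
have := parity_aligned (i := j) (j := i) arr _ Tji.
rewrite ltrD2l ltrN2 => /(_ Uij).
rewrite (@eq_card _ _ [pred k | U j < U k & T j < T k < T i]); last first.
  by move=> k; rewrite !inE ltrD2l ltrN2.
move=> ->; congr (odd _); apply: eq_card => k.
by rewrite !inE !ltrD2l !ltrN2 [in LHS](andbC (U k < _)).
Qed.

Lemma connected_same_sign (g : R * R -> R) (A : set (R * R)) p q :
  connected A -> continuous g -> (forall s, A s -> g s != 0) -> A p -> A q ->
  0 < g p * g q.
Proof.
move=> cA cg g0 Ap Aq.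
have /connected_intervalP itv : connected [set g x | x in A].
  by apply: connected_continuous_connected => //; exact: continuous_subspaceT.
have n0 : ~ [set g x | x in A] 0 by case=> s As E; have := g0 s As; rewrite E eqxx.
have ip : [set g x | x in A] (g p) by exists p.
have iq : [set g x | x in A] (g q) by exists q.
have := g0 p Ap; have := g0 q Aq.
case: (ltgtP (g p) 0) => // hp; case: (ltgtP (g q) 0) => // hq _ _.
- by rewrite nmulr_rgt0.
- by exfalso; apply: n0; apply: (itv _ _ ip iq); rewrite !ltW.
- by exfalso; apply: n0; apply: (itv _ _ iq ip); rewrite !ltW.
- by rewrite mulr_gt0.
Qed.

(** A line meets a circle in at most two points: if [a] and [b] were parallel, the equation of the
    circle would give [dot a b = dot a a = dot b b], hence [a = b]. *)
Lemma circle_not_collinear o r s p q : disk_boundary o r s ->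
  disk_boundary o r p -> disk_boundary o r q -> p != s -> q != s -> q != p ->
  cross (p - s) (q - s) != 0.
Proof.
move=> hs hp hq ps qs qp; set a := p - s; set b := q - s.
have a0 : 0 < dot a a by apply: dot_gt0; rewrite subr_eq0.
have b0 : 0 < dot b b by apply: dot_gt0; rewrite subr_eq0.
have ab0 : 0 < dot (b - a) (b - a).
  by apply: dot_gt0; rewrite subr_eq0 /a /b (inj_eq (addIr _)).
have ca : dot a a = 2 * dot (o - s) a.
  by move: hs hp; rewrite /disk_boundary /dist2 /a /dot /=; lra.
have cb : dot b b = 2 * dot (o - s) b.
  by move: hs hq; rewrite /disk_boundary /dist2 /b /dot /=; lra.
apply/negP => /eqP C.
have E1 : dot a a * dot (o - s) b = dot a b * dot (o - s) a.
  apply/eqP; rewrite -subr_eq0; apply/eqP.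
  transitivity (cross a b * cross a (o - s)); last by rewrite C mul0r.
  by rewrite /dot /cross /=; ring.
have E2 : dot b b * dot (o - s) a = dot a b * dot (o - s) b.
  apply/eqP; rewrite -subr_eq0; apply/eqP.
  transitivity (- cross a b * cross b (o - s)); last by rewrite C oppr0 mul0r.
  by rewrite /dot /cross /=; ring.
have ab : dot a b = dot b b.
  by apply: (mulIf (lt0r_neq0 a0));
    transitivity (2 * (dot a b * dot (o - s) a)); [rewrite ca | rewrite -E1 cb]; ring.
have ba : dot a b = dot a a.
  by apply: (mulIf (lt0r_neq0 b0));
    transitivity (2 * (dot a b * dot (o - s) b)); [rewrite cb | rewrite -E2 ca]; ring.
have : dot (b - a) (b - a) = dot b b + dot a a - 2 * dot a b.
  by rewrite /dot /=; ring.
by lra.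
Qed.

(** The arc is the projection from [s] of the chord from [p] to [q] onto the circle. It avoids [g]
    because the chord stays strictly on one side of the line through [s] and [g]. *)
Lemma circle_arc o r s p q g : disk_boundary o r s ->
  disk_boundary o r p -> disk_boundary o r q -> p != s -> q != s ->
  0 < cross (g - s) (p - s) * cross (g - s) (q - s) ->
  exists z, [/\ continuous_on z 0 1, z 0 = p, z 1 = q,
    forall x, 0 <= x <= 1 -> disk_boundary o r (z x) &
    avoids z 0 1 s /\ avoids z 0 1 g].
Proof.
move=> hs hp hq ps qs side.
have le_disk p' : disk_boundary o r p' -> disk o r p'.
  by rewrite /disk_boundary /disk /= => ->.
pose c := o - s.
have cp : 0 < dot c (p - s) by apply: disk_half_plane hs (le_disk _ hp) ps.
have cq : 0 < dot c (q - s) by apply: disk_half_plane hs (le_disk _ hq) qs.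
pose h := segment (p - s) (q - s).
have hE l x : dot l (h x) = (1 - x) * dot l (p - s) + x * dot l (q - s).
  by rewrite /h /segment /dot /= -![_ *: _]/(_ * _); ring.
have ch x : 0 <= x <= 1 -> 0 < dot c (h x).
  move=> x01; rewrite hE -oppr_lt0 opprD -!mulrN.
  by apply: convex_lt; rewrite ?oppr_lt0.
(* The nonzero factor for which [s + k x *: h x] is on the circle again. *)
pose k x := 2 * dot c (h x) / dot (h x) (h x).
have hh x : 0 <= x <= 1 -> 0 < dot (h x) (h x).
  by move=> /ch/dot_neq0/dot_gt0.
have k0 x : 0 <= x <= 1 -> 0 < k x.
  by move=> x01; rewrite /k divr_gt0 ?hh // mulr_gt0 ?ch.
have Ch := @segment_continuous R (p - s) (q - s) 0 1.
pose z x := s + k x *: h x.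
have diam p' : disk_boundary o r p' -> 2 * dot c (p' - s) = dot (p' - s) (p' - s).
  by move: hs; rewrite /disk_boundary /dist2 /c /dot /=; lra.
have i0 : 0 <= (0 : R) <= 1 by rewrite lexx ler01.
have i1 : 0 <= (1 : R) <= 1 by rewrite lexx ler01.
exists z; split.
- move=> x x01; have [h1 h2] := Ch x x01.
  have Cd : {for x, continuous (fun y => dot c (h y))}.
    by apply: cvgD; apply: cvgM => //; exact: cvg_cst.
  have Cn : {for x, continuous (fun y => dot (h y) (h y))}.
    by apply: cvgD; apply: cvgM.
  have Ck : {for x, continuous k}.
    apply: cvgM; first by apply: cvgM; [exact: cvg_cst | exact: Cd].
    by apply: cvgV; [rewrite gt_eqF // hh | exact: Cn].
  by split; apply: cvgD; [exact: cvg_cst | exact: (cvgM Ck h1)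
                         |exact: cvg_cst | exact: (cvgM Ck h2)].
- have h0E : h 0 = p - s by rewrite /h /segment scale0r addr0.
  rewrite /z /k h0E diam // divff ?scale1r ?subrKC //.
  by apply: lt0r_neq0; rewrite -h0E hh.
- have h1E : h 1 = q - s by rewrite /h /segment scale1r subrKC.
  rewrite /z /k h1E diam // divff ?scale1r ?subrKC //.
  by apply: lt0r_neq0; rewrite -h1E hh.
- move=> x x01; move: hs; rewrite /disk_boundary /= => <-.
  apply/eqP; rewrite -subr_eq0; apply/eqP.
  transitivity (k x * (k x * dot (h x) (h x) - 2 * dot c (h x))).
    by rewrite /z /c /dist2 /dot /= -![_ *: _]/(_ * _); ring.
  by rewrite {2}/k divfK ?subrr ?mulr0 // gt_eqF // hh.
have dz l x : dot l (z x - s) = k x * dot l (h x).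
  by rewrite /z /dot /= -![_ *: _]/(_ * _); ring.
split=> x x01; apply/eqP => zE.
  by have := mulr_gt0 (k0 x x01) (ch x x01); rewrite -dz zE subrr /dot /= !mulr0 addr0 ltxx.
(* The form [l], taken from [s], is positive on the side of the line through [s] and [g] that
   contains [p] and [q]. *)
pose l : R * R := cross (g - s) (p - s) *: (- (g - s).2, (g - s).1).
have lE p' : dot l p' = cross (g - s) (p - s) * cross (g - s) p'.
  by rewrite /l scale_pairE /dot /cross /=; ring.
have : 0 < dot l (h x).
  rewrite hE -oppr_lt0 opprD -!mulrN; apply: convex_lt => //; rewrite oppr_lt0 lE //.
  by rewrite -expr2 exprn_even_gt0 //=; apply: contraTneq side => ->; rewrite mul0r ltxx.
rewrite -(pmulr_rgt0 _ (k0 x x01)) -dz zE lE.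
have -> : cross (g - s) (g - s) = 0 by rewrite /cross; ring.
by rewrite mulr0 ltxx.
Qed.

(** Both outgoing branches are followed up to the boundary and joined by a boundary arc that avoids
    the starts [v 0] and [w 0]; the side condition provides this arc. *)
Lemma parity_degree (I : finType) o r v w (U T : I -> R) i :
  arrangement o r v w U T ->
  (forall x, 0 <= x <= 1 -> disk_boundary o r (v x) -> x = 0 \/ x = 1) ->
  (forall x, 0 <= x <= 1 -> disk_boundary o r (w x) -> x = 0 \/ x = 1) ->
  uniq [:: v 0; v 1; w 0; w 1] ->
  0 < cross (w 0 - v 0) (v 1 - v 0) * cross (w 0 - v 0) (w 1 - v 0) ->
  odd #|[pred k | U k < U i & T i < T k]| = odd #|[pred k | T k < T i & U i < U k]|.
Proof.
move=> arr bv bw /= + side; rewrite !inE !negb_or.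
move=> /andP[/and3P[v01 vw vw1] /andP[/andP[v1w0 v1w1] /andP[w01 _]]].
have [ev0 ev1] := arr_endsv arr; have [ew0 ew1] := arr_endsw arr.
have [z [Cz z0 z1 zb [zv zw]]] : exists z, [/\ continuous_on z 0 1, z 0 = v 1, z 1 = w 1,
    forall x, 0 <= x <= 1 -> disk_boundary o r (z x) &
    avoids z 0 1 (v 0) /\ avoids z 0 1 (w 0)].
  by apply: circle_arc => //; rewrite eq_sym.
have /andP[U0 U1] := arr_U arr i; have /andP[T0 T1] := arr_T arr i.
(* Before its end, a curve meets the boundary only at its start, which the arc avoids. *)
have zav c a : (forall x, 0 <= x <= 1 -> disk_boundary o r (c x) -> x = 0 \/ x = 1) ->
    avoids z 0 1 (c 0) -> a < 1 -> forall x, 0 <= x <= a -> avoids z 0 1 (c x).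
  move=> bc zc a1 x /andP[x0 xa] y y01; apply/eqP => E.
  have := zb y y01; rewrite E => /bc; rewrite x0 (le_trans xa (ltW a1)) => /(_ isT).
  case=> xE; first by have := zc y y01; rewrite E xE eqxx.
  by move: xa; rewrite xE leNgt a1.
have := corner_parity arr (i := i) (b := 1) (d := 1) _ _ Cz _ z0 z1 (zav _ _ bv zv U1)
   (zav _ _ bw zw T1).
rewrite U1 T1 lexx => /(_ isT isT) H.
rewrite (@eq_card _ _ [pred k | U k < U i & T i < T k < 1]); last first.
  by move=> k; rewrite !inE; have /andP[_ ->] := arr_T arr k; rewrite andbT.
rewrite H; last by move=> x /zb; rewrite /disk_boundary /disk /= => ->.
congr (odd _); apply: eq_card => k.
by rewrite !inE; have /andP[_ ->] := arr_U arr k; rewrite andbT.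
Qed.

End Relations.

(** * Inversions of a meander *)

(** All comparisons of [x] with two bounds [a < b] at once, to compare sums of indicators term by
    term. *)
Variant position_spec (d : Order.disp_t) (X : orderType d) (a b x : X) :
    bool -> bool -> bool -> bool -> bool -> bool -> Type :=
  | Below : position_spec a b x true false true false false false
  | AtLeft : position_spec a b x false false true false true false
  | Between : position_spec a b x false true true false false false
  | AtRight : position_spec a b x false true false false false true
  | Above : position_spec a b x false true false true false false.

Lemma positionP (d : Order.disp_t) (X : orderType d) (a b x : X) : (a < b)%O ->
  position_spec a b x (x < a)%O (a < x)%O (x < b)%O (b < x)%O (x == a) (x == b).
Proof.
move=> ab; case: (ltgtP x a) => [xa|ax|->].
- by rewrite (lt_trans xa ab) (lt_gtF (lt_trans xa ab)) (lt_eqF (lt_trans xa ab)); constructor.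
- by case: (ltgtP x b) => _; constructor.
- by rewrite ab (lt_gtF ab) (lt_eqF ab); constructor.
Qed.

Section Inversions.
Local Open Scope classical_set_scope.
Local Open Scope ring_scope.
Variables (R : realType) (I : finType).
Implicit Types (U T : I -> R) (i j k : I).

Definition inverted U T i j := (U i < U j) (+) (T i < T j).

Lemma invertedC U T i j : injective U -> injective T ->
  inverted U T i j = inverted U T j i.
Proof.
move=> Ui Ti; have [->|ij] := eqVneq i j; first by [].
have : U i != U j by rewrite (inj_eq Ui).
have : T i != T j by rewrite (inj_eq Ti).
by rewrite /inverted; case: (ltgtP (U i)); case: (ltgtP (T i)).
Qed.

Lemma card_bool_sum (A : pred I) : #|A| = (\sum_k (A k : nat))%N.
Proof.
by rewrite -sum1_card big_mkcond; apply: eq_bigr => k _; rewrite unfold_in; case: (A k). Qed.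

Lemma card_inverted U T i : injective U -> injective T ->
  #|[pred k | inverted U T i k]| =
  (#|[pred k | (U k < U i)%R & (T i < T k)%R]| + #|[pred k | (T k < T i)%R & (U i < U k)%R]|)%N.
Proof.
move=> Ui Ti; rewrite !card_bool_sum -big_split; apply: eq_bigr => k _ /=.
have : (U k == U i) = (T k == T i) by rewrite !inj_eq.
by rewrite /inverted; case: (ltgtP (U k)); case: (ltgtP (T k)).
Qed.

(** The common neighbours of [i] and [j] are compared with all neighbours of [i], whose number is
    even by the first parity hypothesis. Those which are missing fill two rectangles with counts of
    equal parity, together with [j] itself when [i] and [j] are inverted. *)
Lemma inverted_pair U T i j : injective U -> injective T -> i != j ->
  (forall k, odd #|[pred k' | U k' < U k & T k < T k']|
     = odd #|[pred k' | T k' < T k & U k < U k']|) ->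
  (forall i j, U i < U j -> T i < T j ->
     odd #|[pred k | U k < U i & T i < T k < T j]|
     = odd #|[pred k | T k < T i & U i < U k < U j]|) ->
  (forall i j, U i < U j -> T j < T i ->
     odd #|[pred k | U j < U k & T j < T k < T i]|
     = odd #|[pred k | T k < T j & U i < U k < U j]|) ->
  odd #|[pred k | inverted U T i k & inverted U T k j]| = inverted U T i j.
Proof.
move=> Ui Ti ij deg al inv.
wlog Uij : i j ij / U i < U j.
  move=> H; have : U i != U j by rewrite (inj_eq Ui).
  case: (ltgtP (U i) (U j)) => // [lij|gij] _; first exact: H.
  rewrite invertedC // -H // 1?eq_sym //; congr (odd _); apply: eq_card => k.
  by rewrite !inE andbC (@invertedC _ _ i) // (@invertedC _ _ j).
have Tij : T i != T j by rewrite (inj_eq Ti).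
have e1 k : (U k == U i) = (T k == T i) by rewrite !inj_eq.
have e2 k : (U k == U j) = (T k == T j) by rewrite !inj_eq.
rewrite [RHS]/inverted Uij; case: (ltgtP (T i) (T j)) Tij => // Tij _ /=.
  have card : (#|[pred k | inverted U T i k & inverted U T k j]|
     + (#|[pred k | (U k < U i)%R & (T i < T k < T j)%R]|
        + #|[pred k | (T k < T i)%R & (U i < U k < U j)%R]|)
     = #|[pred k | (U k < U i)%R & (T i < T k)%R]| + #|[pred k | (T k < T i)%R & (U i < U k)%R]|)%N.
    rewrite !card_bool_sum -!big_split; apply: eq_bigr => k _ /=.
    rewrite /inverted; move: (e1 k) (e2 k).
    by case: (positionP (U k) Uij); case: (positionP (T k) Tij).
  by have := congr1 odd card; rewrite !oddD deg al // !addbb addbF.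
(* Here [j] is a neighbour of [i] but not of itself; the term [#|pred1 j|] makes the count odd. *)
have card : (#|[pred k | inverted U T i k & inverted U T k j]|
   + (#|[pred k | (U j < U k)%R & (T j < T k < T i)%R]|
      + #|[pred k | (T k < T j)%R & (U i < U k < U j)%R]|) + #|pred1 j|
   = #|[pred k | (U k < U i)%R & (T i < T k)%R]| + #|[pred k | (T k < T i)%R & (U i < U k)%R]|)%N.
  rewrite !card_bool_sum -!big_split; apply: eq_bigr => k _ /=.
  rewrite /inverted -(inj_eq Ui k j); move: (e1 k) (e2 k).
  by case: (positionP (U k) Uij); case: (positionP (T k) Tij).
have := congr1 odd card; rewrite card1 !oddD deg inv // !addbb addbF.
by case: (odd _).
Qed.

End Inversions.

(** * From a meander to an arrangement of two curves *)

Section MeanderArrangement.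
Local Open Scope classical_set_scope.
Local Open Scope ring_scope.
Variable R : realType.

Lemma smooth_derivable_curve (c : R -> R * R) : smooth_curve c -> derivable_curve c.
Proof. by move=> [s1 s2] t; split; [exact: (s1 0%N t) | exact: (s2 0%N t)]. Qed.

(** Labels follow [ell], so [T] increases with the label; the point labelled [i] is met along [mu]
    in position [pi^-1 i], which gives the order of [U]. *)
Lemma meander_arrangement n (M : meander R n) (pi : 'S_n) : is_permutation_of M pi ->
  exists U T : 'I_n -> R,
  [/\ arrangement (disk_center M) (disk_radius M) (mu M) (ell M) U T,
      forall i j, (U i < U j) = (pi^-1%g i < pi^-1%g j)%N &
      forall i j, (T i < T j) = (i < j)%N].
Proof.
move=> [x [y [[t [t01 tinc xE xX]] [s [s01 sinc yE yX]] yx]]].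
have mono (f : 'I_n -> R) : (forall i j : 'I_n, (i < j)%N -> f i < f j) ->
    forall i j : 'I_n, (f i < f j) = (i < j)%N.
  move=> f_inc i j; apply/idP/idP; last exact: f_inc.
  move=> fij; rewrite ltnNge leq_eqVlt; apply/negP => /orP[/eqP/val_inj E|/f_inc].
    by move: fij; rewrite E ltxx.
  by move=> /(lt_trans fij); rewrite ltxx.
have inj (f : 'I_n -> R) : (forall i j : 'I_n, (i < j)%N -> f i < f j) -> injective f.
  move=> f_inc i j E; apply: val_inj.
  by case: (ltngtP i j) => // /f_inc; rewrite E ltxx.
exists (fun i => s (pi^-1%g i)), t; split; [|by move=> i j; exact: mono|exact: mono].
have [mu0 mu1] := mu_ends M; have [el0 el1] := ell_ends M.
have [bm0 bm1 bp0 bp1] := points_on_boundary M.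
have [smu imu vmu kmu pmu] := mu_embedding M.
have [sel iel vel kel pel] := ell_embedding M.
have cr i : ell M (t i) = mu M (s (pi^-1%g i)).
  by rewrite -xE -yE yx permKV.
have := points_distinct M; rewrite /= !inE !negb_or.
move=> /andP[/and3P[m01 mp0 mp1] /andP[/andP[m1p0 m1p1] /andP[p01 _]]].
(* A common point on the boundary would be an end of both curves, but the four ends are distinct; so
   crossings have interior parameters. *)
have ends a b : a \in `[0, 1] -> b \in `[0, 1] -> ell M a = mu M b ->
    0 < a < 1 /\ 0 < b < 1.
  move=> a01 b01 E.
  suff : ~ disk_boundary (disk_center M) (disk_radius M) (mu M b).
    move=> nb; have na := nb; rewrite -E in na.
    move: nb na; rewrite pmu // pel // => nb na.
    move: a01 b01; rewrite !in_itv /= => /andP[a0 a1] /andP[b0 b1].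
    rewrite !lt_neqAle a0 a1 b0 b1 !andbT; split; apply/andP; split; apply/eqP => h.
    + by apply: na; left.
    + by apply: na; right.
    + by apply: nb; left.
    + by apply: nb; right.
  move=> nb; have na := nb; rewrite -E in na.
  move: nb na; rewrite pmu // pel // => -[] hb [] ha;
    move: E; rewrite ha hb ?mu0 ?mu1 ?el0 ?el1 => E.
  + by rewrite E eqxx in mp0.
  + by rewrite E eqxx in mp1.
  + by rewrite E eqxx in m1p0.
  + by rewrite E eqxx in m1p1.
apply: Arrangement.
- exact: smooth_derivable_curve.
- exact: smooth_derivable_curve.
- by move=> a b a01 b01; apply: imu; rewrite in_itv.
- by move=> a b a01 b01; apply: iel; rewrite in_itv.
- by move=> a a01; apply: kmu; rewrite in_itv.
- by move=> a a01; apply: kel; rewrite in_itv.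
- by rewrite mu0 mu1.
- by rewrite el0 el1.
- by move=> k; have [] := ends _ _ (t01 k) (s01 _) (cr k).
- by move=> k; have [] := ends _ _ (t01 k) (s01 _) (cr k).
- by move=> i j /(inj _ sinc)/perm_inj.
- exact: inj.
- exact: cr.
- move=> a b a01 b01 E.
  have : crossings M (ell M b).
    by split; [exists a => //; rewrite /= in_itv | exists b; rewrite /= ?in_itv].
  rewrite -xX => -[k _ xk]; exists k.
  have bt : b = t k by apply: iel; [rewrite in_itv | exact: t01 | rewrite -xk xE].
  by split=> //; apply: imu; [rewrite in_itv | exact: s01 | rewrite -cr -bt].
move=> k; exact: (mu_ell_transverse (s01 _) (t01 k) (esym (cr k))).
Qed.

(** The line through [m0] and [p0] meets the circle only there, so its two sides cannot be joined
    within a component of the circle without these points. *)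
Lemma meander_side n (M : meander R n) :
  0 < cross (ell M 0 - mu M 0) (mu M 1 - mu M 0)
    * cross (ell M 0 - mu M 0) (ell M 1 - mu M 0).
Proof.
have [mu0 mu1] := mu_ends M; have [el0 el1] := ell_ends M.
have [bm0 bm1 bp0 bp1] := points_on_boundary M.
have := points_distinct M; rewrite /= !inE !negb_or.
move=> /andP[/and3P[m01 mp0 mp1] /andP[/andP[m1p0 m1p1] /andP[p01 _]]].
rewrite mu0 mu1 el0 el1.
have [x [Cm1 Cp1]] := points_component M.
pose g (q : R * R) := cross (p0 M - m0 M) (q - m0 M).
apply: (@connected_same_sign R g _ _ _ (@component_connected _ _ _) _ _ Cm1 Cp1).
- move=> q; rewrite /g /cross.
  apply: cvgB; apply: cvgM; try exact: cvg_cst; apply: cvgB; try exact: cvg_cst.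
    exact: cvg_snd.
  exact: cvg_fst.
move=> q /connected_component_sub[bq /= nq].
apply: (circle_not_collinear bm0 bp0 bq); rewrite 1?eq_sym //.
  by apply/eqP => E; apply: nq; left.
by apply/eqP => E; apply: nq; right.
Qed.

(** As inversion is symmetric, these are the diagonal and the off-diagonal entries of [V^2 = V] for
    the crossings. *)
Lemma meander_inversions n (M : meander R n) (pi : 'S_n) : is_permutation_of M pi ->
  let inv (i j : 'I_n) := (pi^-1%g i < pi^-1%g j)%N (+) (i < j)%N in
  (forall i, odd #|[pred k | inv i k]| = false) /\
  (forall i j, i != j -> odd #|[pred k | inv i k & inv k j]| = inv i j).
Proof.
move=> /meander_arrangement[U [T [arr UE TE]]] /=.
have [mu0 mu1] := mu_ends M; have [el0 el1] := ell_ends M.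
have [_ _ _ _ pmu] := mu_embedding M.
have [_ _ _ _ pel] := ell_embedding M.
have deg i : odd #|[pred k | U k < U i & T i < T k]| = odd #|[pred k | T k < T i & U i < U k]|.
  apply: (parity_degree i arr).
  - by move=> x x01 h; apply/pmu; rewrite // in_itv.
  - by move=> x x01 h; apply/pel; rewrite // in_itv.
  - by rewrite mu0 mu1 el0 el1; exact: points_distinct.
  - exact: meander_side.
have Ui := arr_Uinj arr; have Ti := arr_Tinj arr.
have invE i j : (pi^-1%g i < pi^-1%g j)%N (+) (i < j)%N = inverted U T i j.
  by rewrite /inverted UE TE.
split=> [i|i j ij].
  rewrite (@eq_card _ _ [pred k | inverted U T i k]); last by move=> k; rewrite !inE invE.
  by rewrite card_inverted // oddD deg addbb.
rewrite invE -(inverted_pair Ui Ti ij deg).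
- by congr (odd _); apply: eq_card => k; rewrite !inE !invE.
- by move=> i' j'; exact: (parity_aligned arr).
- by move=> i' j'; exact: (parity_inverted arr).
Qed.

End MeanderArrangement.

(** * The interlacement graph *)

Lemma filter_pair (X : eqType) (s : seq X) (a b : X) : uniq s ->
  a \in s -> b \in s -> a != b ->
  [seq x <- s | (x == a) || (x == b)]
  = if (index a s < index b s)%N then [:: a; b] else [:: b; a].
Proof.
move=> + + + ab; elim: s => //= x s IH /andP[xs us]; rewrite !inE.
have other y z : y \notin s -> z \in s ->
    [seq x <- s | (x == y) || (x == z)] = [:: z].
  move=> ys zs; rewrite -(filter_pred1_uniq us zs); apply: eq_in_filter => t ts /=.
  by have -> : (t == y) = false by apply: contraNF ys => /eqP <-.
have [xa|xa] := eqVneq x a.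
  subst a; rewrite ?eqxx [b == x]eq_sym (negbTE ab) /= => _ bs.
  by rewrite other.
move=> sa; have [xb|xb] := eqVneq x b.
  subst b; rewrite ?eqxx /= => _; congr cons; rewrite -(other x a) //.
  by apply: eq_filter => y; rewrite orbC.
by move=> sb; rewrite IH // ltnS.
Qed.

(** Each half contains either letter once, so the letters alternate exactly when both halves list
    them in the same order. *)
Lemma interlaced_cat (s1 s2 : seq nat) a b : uniq s1 -> uniq s2 ->
  a \in s1 -> b \in s1 -> a \in s2 -> b \in s2 ->
  interlaced (s1 ++ s2) a b
  = (a != b) && ((index a s1 < index b s1)%N == (index a s2 < index b s2)%N).
Proof.
move=> u1 u2 a1 b1 a2 b2; rewrite /interlaced; have [//|ab] /= := eqVneq a b.
rewrite filter_cat !filter_pair // !inE.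
have ba : b != a by rewrite eq_sym.
by do 2!case: ltnP => _; rewrite /= !eqseq_cons ?eqxx ?(negbTE ab) ?(negbTE ba).
Qed.

Lemma natr_F2 k : k%:R = (odd k)%:R :> 'F_2.
Proof.
by elim: k => // k IH; rewrite mulrS IH /=; case: (odd k); apply: val_inj.
Qed.

Section Interlacement.
Variables (n : nat) (pi : 'S_n).

Definition word1 : seq nat := iota 0 n.+1 ++ theta n.
Definition word2 : seq nat := 0%N :: [seq (pi i).+1 | i <- enum 'I_n] ++ theta n.

Lemma word1E : word1 = iota 0 (n.+1 + odd n).
Proof. by rewrite iotaD /word1 /theta; case: (odd n). Qed.

Let f (i : 'I_n) : nat := (pi i).+1.

Let f_inj : injective f.
Proof. by move=> i j [] /val_inj/perm_inj. Qed.

Lemma letterP c : (c < n.+1 + odd n)%N ->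
  [\/ c = 0%N, exists i : 'I_n, c = i.+1 | odd n /\ c = n.+1].
Proof.
case: c => [|c]; first by constructor 1.
have [cn _|nc] := ltnP c n; first by constructor 2; exists (Ordinal cn).
rewrite addSn ltnS; case: (odd n) => /= h; constructor 3.
  by split=> //; congr _.+1; apply/eqP; rewrite eqn_leq nc andbT; move: h; rewrite addn1 ltnS.
by move: h; rewrite addn0 ltnNge nc.
Qed.

(** The successor on the right accounts for the leading letter [0]. *)
Lemma word2_index (i : 'I_n) : index i.+1 word2 = (pi^-1%g i).+1.
Proof.
rewrite /word2 /= index_cat; have -> : i.+1 = f (pi^-1%g i) by rewrite /f permKV.
by rewrite (mem_map f_inj) mem_enum (index_map f_inj) index_enum_ord.
Qed.

Lemma theta_notin : n.+1 \notin [seq f i | i <- enum 'I_n].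
Proof.
apply/mapP => -[i _ [E]]; by have := ltn_ord (pi i); rewrite -E ltnn.
Qed.

Lemma word2_index_theta : index n.+1 word2 = n.+1.
Proof.
rewrite /word2 /= index_cat (negbTE theta_notin) size_map size_enum_ord.
by rewrite /theta; case: (odd n); rewrite /= ?eqxx addn0.
Qed.

Lemma word2_uniq : uniq word2.
Proof.
rewrite /word2 /= mem_cat cat_uniq (map_inj_uniq f_inj) enum_uniq /=.
rewrite /theta; case: (odd n); rewrite /= ?orbF ?(negbTE theta_notin) !andbT;
  by apply/mapP => -[].
Qed.

Lemma mem_word2 c : (c < n.+1 + odd n)%N -> c \in word2.
Proof.
case/letterP => [->|[i ->]|[on ->]]; first by rewrite mem_head.
  rewrite inE mem_cat; apply/orP; right; apply/orP; left.
  by apply/mapP; exists (pi^-1%g i); rewrite ?mem_enum ?permKV.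
by rewrite inE mem_cat /theta on inE eqxx !orbT.
Qed.

(** A letter is its own index in [word1], so the order there is the order of numbers. *)
Definition inversion (a b : nat) : bool :=
  (a < b)%N (+) (index a word2 < index b word2)%N.

Lemma interlaced_W a b : (a < n.+1 + odd n)%N -> (b < n.+1 + odd n)%N ->
  interlaced (W pi) a b = (a != b) && ~~ inversion a b.
Proof.
move=> am bm; have -> : W pi = word1 ++ word2 by [].
rewrite interlaced_cat ?word2_uniq ?mem_word2 // word1E ?iota_uniq ?mem_iota //.
have idx c : (c < n.+1 + odd n)%N -> index c (iota 0 (n.+1 + odd n)) = c.
  move=> cm; rewrite -[X in index X _](nth_iota 0 0 cm).
  by rewrite index_uniq ?size_iota ?iota_uniq.
by rewrite !idx // /inversion negb_add.
Qed.

Lemma inversionS (i j : 'I_n) :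
  inversion i.+1 j.+1 = (pi^-1%g i < pi^-1%g j)%N (+) (i < j)%N.
Proof. by rewrite /inversion !word2_index !ltnS addbC. Qed.

(** The letter [0] is first in both words and the letter [n.+1], when present, is last in both. *)
Lemma inversion_letter a b : (b < n.+1 + odd n)%N ->
  a = 0%N \/ odd n /\ a = n.+1 ->
  inversion a b = false /\ inversion b a = false.
Proof.
move=> bm; rewrite /inversion => -[->|[on ->]].
  have i0 : index 0%N word2 = 0%N by [].
  by rewrite i0 !ltn0; split=> //; case/letterP: bm => [->|[i ->]|[_ ->]].
rewrite word2_index_theta; case/letterP: bm => [->|[i ->]|[_ ->]] //.
- have lt (k : 'I_n) : (n < k)%N = false by rewrite ltnNge ltnW.
  by rewrite word2_index !ltnS !ltn_ord !lt.
by rewrite word2_index_theta ltnn.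
Qed.

Lemma sum_letters (F : nat -> nat) : F 0%N = 0%N -> (odd n -> F n.+1 = 0%N) ->
  (\sum_(c < n.+1 + odd n) F c = \sum_(i < n) F i.+1)%N.
Proof.
move=> F0 Fn; rewrite big_split_ord big_ord_recl /= F0 add0n.
rewrite [X in (_ + X)%N]big1 ?addn0 // => i _.
have on : odd n by case: (odd n) i => // -[].
by rewrite -[RHS]Fn //; congr F; case: (odd n) i => // -[[|//] ? /=]; rewrite addn0.
Qed.

Hypothesis even_degree : forall i : 'I_n, odd #|[pred k : 'I_n | inversion i.+1 k.+1]| = false.
Hypothesis odd_pairs : forall i j : 'I_n, i != j ->
  odd #|[pred k : 'I_n | inversion i.+1 k.+1 & inversion k.+1 j.+1]| = inversion i.+1 j.+1.

Lemma inversionC a b : (a < n.+1 + odd n)%N -> (b < n.+1 + odd n)%N ->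
  inversion a b = inversion b a.
Proof.
move=> am bm; have [->|ab] := eqVneq a b; first by [].
have : index a word2 != index b word2.
  apply: contra ab => /eqP E; rewrite -(nth_index 0%N (mem_word2 am)) E.
  by rewrite nth_index // mem_word2.
by rewrite /inversion; case: (ltngtP a b) ab => // _ _; case: ltngtP.
Qed.

(** The identity [V^2 = V] entry by entry on all letters: the extra letters contribute nothing, and
    the hypotheses give the entries between crossings. *)
Lemma odd_inversion_sum a b : (a < n.+1 + odd n)%N -> (b < n.+1 + odd n)%N ->
  odd (\sum_(c < n.+1 + odd n) (inversion a c && inversion c b : nat)) = inversion a b.
Proof.
move=> am bm.
rewrite (@sum_letters (fun c => inversion a c && inversion c b : nat)); last first.
- move=> on; have [|_ ->] // := @inversion_letter n.+1 a am; by right.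
- by have [|_ ->] // := @inversion_letter 0 a am; left.
case: (letterP am) => [a0|[i aE]|aT].
- rewrite big1 => [|k _]; rewrite ?(inversion_letter bm (or_introl a0)).1 //.
  have km : (k.+1 < n.+1 + odd n)%N by rewrite addSn ltnS ltn_addr.
  by rewrite (inversion_letter km (or_introl a0)).1.
- case: (letterP bm) => [b0|[j bE]|bT].
  + rewrite big1 => [|k _]; rewrite ?(inversion_letter am (or_introl b0)).2 //.
    have km : (k.+1 < n.+1 + odd n)%N by rewrite addSn ltnS ltn_addr.
    by rewrite (inversion_letter km (or_introl b0)).2 andbF.
  + rewrite aE bE -card_bool_sum.
    have [<-|ij] := eqVneq i j; last exact: odd_pairs.
    rewrite [RHS]/inversion !ltnn -[RHS](even_degree i); congr (odd _).
    apply: eq_card => k; rewrite [LHS]unfold_in [RHS]unfold_in /= [X in _ && X]inversionC ?andbb //.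
    + by rewrite addSn ltnS ltn_addr.
    + by rewrite -aE.
  + rewrite big1 => [|k _]; rewrite ?(inversion_letter am (or_intror bT)).2 //.
    have km : (k.+1 < n.+1 + odd n)%N by rewrite addSn ltnS ltn_addr.
    by rewrite (inversion_letter km (or_intror bT)).2 andbF.
rewrite big1 => [|k _]; rewrite ?(inversion_letter bm (or_intror aT)).1 //.
have km : (k.+1 < n.+1 + odd n)%N by rewrite addSn ltnS ltn_addr.
by rewrite (inversion_letter km (or_intror aT)).1.
Qed.

(** The diagonal of [V^2 = V]: since [V] is symmetric with zero diagonal, its column sums vanish
    modulo 2. *)
Lemma odd_inversion_col b : (b < n.+1 + odd n)%N ->
  odd (\sum_(c < n.+1 + odd n) (inversion c b : nat)) = false.
Proof.
move=> bm; have <- : inversion b b = false by rewrite /inversion !ltnn.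
rewrite -odd_inversion_sum //; congr (odd _); apply: eq_bigr => c _.
by rewrite [inversion b c]inversionC ?andbb.
Qed.

End Interlacement.

(** * The matrix computation over the field with two elements *)

Lemma sum_F2 m (P : 'I_m -> bool) :
  \sum_c (P c)%:R = (odd (\sum_c (P c : nat)))%:R :> 'F_2.
Proof. by rewrite -natr_F2 natr_sum. Qed.

Theorem theorem4p6 (R : realType) (n : nat) (pi : 'S_n) :
  (1 <= n)%N -> meandric R pi ->
  adjacency_matrix 'F_2 (Gamma pi) *m adjacency_matrix 'F_2 (Gamma pi)
    = adjacency_matrix 'F_2 (Gamma pi).
Proof.
move=> _ [M /meander_inversions[deg0 pairs0]].
have deg (i : 'I_n) : odd #|[pred k : 'I_n | inversion pi i.+1 k.+1]| = false.
  by rewrite -(deg0 i); congr (odd _); apply: eq_card => k; rewrite !inE inversionS.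
have pairs (i j : 'I_n) : i != j ->
    odd #|[pred k : 'I_n | inversion pi i.+1 k.+1 & inversion pi k.+1 j.+1]|
    = inversion pi i.+1 j.+1.
  move=> ij; rewrite inversionS -(pairs0 i j ij); congr (odd _).
  by apply: eq_card => k; rewrite !inE !inversionS.
pose m := (n.+1 + odd n)%N.
have m_odd : odd m by rewrite oddD /=; case: (odd n).
pose J : 'M['F_2]_m := const_mx 1.
pose V : 'M['F_2]_m := \matrix_(a, b) (inversion pi a b)%:R.
(* On the diagonal [J] and the identity cancel; elsewhere adjacency is the negation of inversion. *)
have AE : adjacency_matrix 'F_2 (Gamma pi) = J + 1%:M + V.
  apply/matrixP => a b; rewrite !mxE /Gamma interlaced_W // -val_eqE.
  have [->|ab] := eqVneq (val a) (val b).
    by rewrite /inversion !ltnn /=; apply: val_inj.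
  by case: (inversion _ _ _); apply: val_inj.
have dbl (X : 'M['F_2]_m) : X + X = 0.
  by apply/matrixP => a b; rewrite !mxE; case: (X a b) => -[|[|k]] ?; apply: val_inj.
(* The square of [J] is [m] times [J], and [m] is odd. *)
have JJ : J *m J = J.
  apply/matrixP => a b; rewrite !mxE (eq_bigr (fun=> true%:R)); last first.
    by move=> c _; rewrite !mxE mulr1.
  by rewrite sum_F2 sum_nat_const card_ord muln1 m_odd.
(* END *)
have JV : J *m V = 0.
  apply/matrixP => a b; rewrite !mxE (eq_bigr (fun c : 'I_m => (inversion pi c b)%:R)).
    by rewrite sum_F2 odd_inversion_col.
  by move=> c _; rewrite !mxE mul1r.
have Vt : V^T = V by apply/matrixP => a b; rewrite !mxE inversionC.
have VJ : V *m J = 0.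
  by rewrite -[LHS]trmxK trmx_mul Vt trmx_const JV trmx0.
have VV : V *m V = V.
  apply/matrixP => a b; rewrite !mxE -(odd_inversion_sum deg pairs) // -sum_F2.
  by apply: eq_bigr => c _; rewrite !mxE -natrM mulnb.
rewrite AE !mulmxDl !mulmxDr !mulmx1 !mul1mx JJ JV VJ VV addr0 add0r.
by rewrite !dbl add0r addr0.
Qed.
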